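(* Let $\mathbb D:\mathcal S_M\to\mathcal S_M$ be the quantum Dirac operator, i.e. the restriction to the quantum spinor bundle $\mathcal S_M\subseteq\mathcal B\otimes\mathbb S$ of $\mathbb D(b\otimes x)=-i\sum_j\partial_j(b)\otimes\gamma(\theta_j)x$, and let $\Delta_{\mathcal S}=-\sum_{ij}\partial_i\partial_j\otimes\gamma(g_{ij})$ be the spinorial Laplacian on $\mathcal S_M$, where $g_{ij}=g(\theta_i,\theta_j)\in\Sigma$. Then $$\mathbb D^2=\Delta_{\mathcal S}+\widehat R ,$$ where $\widehat R:\mathcal S_M\to\mathcal S_M$ is the ''Cliffordization'' of the curvature. Explicitly, $\widehat R\leftrightarrow\nabla^2$ in terms of the identification $\mathrm{cl}[\mathbb V,g,\sigma,\Sigma]\leftrightarrow\mathbb V_\Sigma^\wedge$; that is, $\widehat R$ corresponds to $\nabla^2$ when the exterior-form part of $\nabla^2(b)\in\mathcal B\otimes\mathbb V^{\wedge2}$ is regarded as an element of the Clifford algebra, acting in $\mathbb S$ through $\gamma$.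
   Context: **Group and bundle.** $G$ is a compact matrix quantum group with Hopf $*$-algebra $\mathcal A$ of polynomial functions (coproduct $\phi(a)=a^{(1)}\otimes a^{(2)}$, counit $\epsilon$, antipode $\kappa$). $P=(\mathcal B,i,F)$ is a quantum principal $G$-bundle over a quantum space $M$ represented by a unital $*$-algebra $\mathcal V$: $\mathcal B$ is a unital $*$-algebra, $i:\mathcal V\to\mathcal B$ an injective unital $*$-homomorphism (treated as inclusion), $F:\mathcal B\to\mathcal B\otimes\mathcal A$ a unital $*$-homomorphism with $(\mathrm{id}\otimes\phi)F=(F\otimes\mathrm{id})F$, $(\mathrm{id}\otimes\epsilon)F=\mathrm{id}$, $\mathcal V=\{b: F(b)=b\otimes1\}$, and $q\otimes b\mapsto qF(b)$ maps $\mathcal B\otimes_{\mathcal V}\mathcal B$ onto $\mathcal B\otimes\mathcal A$. Write $F(b)=\sum_kb_k\otimes c_k$. **Coordinate space.** $\mathbb V$ is a finite-dimensional complex vector space (the left-invariant part of a $*$-covariant bicovariant $\mathcal A$-bimodule) with an antilinear involution $*$, a right $\mathcal A$-module structure $\circ$ and a right coaction $\varkappa:\mathbb V\to\mathbb V\otimes\mathcal A$ such that $\varkappa*=( *\otimes* )\varkappa$, $(\theta\circ a)^*=\theta^*\circ\kappa(a)^*$, $\varkappa(\theta\circ a)=\sum_k(\theta_k\circ a^{(2)})\otimes\kappa(a^{(1)})c_ka^{(3)}$ if $\varkappa(\theta)=\sum_k\theta_k\otimes c_k$. $\tau(\eta\otimes\vartheta)=\sum_k\vartheta_k\otimes(\eta\circ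 c_k)$ is the associated braid operator. $\theta_1,\dots,\theta_d$ is a basis of $\mathbb V$. **Quantum metric.** $\sigma:\mathbb V\otimes\mathbb V\to\mathbb V\otimes\mathbb V$ is an invertible braid operator with $*\sigma=\sigma*$ (where $(x\otimes y)^*=y^*\otimes x^*$), compatible with $\circ$ and $\varkappa$; $\Sigma$ is a unital $*$-algebra and $g:\mathbb V\otimes\mathbb V\to\Sigma$ is linear with $g\sigma=g$, $g(x,y)^*=g(y^*,x^* )$, $(g_{ij})=(g(\theta_i,\theta_j))$ an invertible matrix over $\Sigma$, and $\Sigma$ generated by the entries of $g$ and $g^{-1}$. There is a twisting $\nu_\Sigma:\mathbb V\otimes\Sigma\to\Sigma\otimes\mathbb V$, coming from a unital homomorphism $\Sigma\to M_d(\Sigma)$, with $\nu_\Sigma(\mathrm{id}\otimes g)=(g\otimes\mathrm{id})(\mathrm{id}\otimes\sigma)(\sigma^{-1}\otimes\mathrm{id})$; it makes $\mathbb V_\Sigma=\Sigma\otimes\mathbb V$ a $\Sigma$-bimodule. With $g\cdot g:\mathbb V^{\otimes4}\to\Sigma$, $x\otimes y\otimes z\otimes t\mapsto g(x,y)g(z,t)$, one has $g\cdot g=(g\cdot g)(\mathrm{id}\otimes\sigma\otimes\mathrm{id})(\sigma^{\mp1}\otimes\sigma^{\pm1})(\mathrm{id}\otimes\sigma^{-1}\otimes\mathrm{id})$, so that $\sigma,g$ extend to $\Sigma$-bilinear maps on $\mathbb V_\Sigma\otimes_\Sigma\mathbb V_\Sigma$. $\Sigma$ is realized by (possibly unbounded)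 operators on a common dense domain in $l^2(\mathbb Z)$, and $\langle\psi,\xi\rangle=g(\psi^*,\xi)$ is strictly positive on $\mathbb V_\Sigma$ (hence on its tensor powers). $\Sigma$ carries a right $\mathcal A$-module structure and a coaction $\varkappa_\Sigma$ determined by $g(x,y)\circ a=g(x\circ a^{(1)},y\circ a^{(2)})$, $\varkappa_\Sigma g(x,y)=(g\otimes\mathrm{id})\varkappa(x\otimes y)$. **Exterior and Clifford algebras.** $A^n_\sigma=\sum_{\pi\in S_n}(-1)^{\ell(\pi)}\sigma_\pi$ are the braided antisymmetrizers, assumed positive and such that $\mathrm{im}(A_\sigma^n)$ is the space of $\tau$-antisymmetric $n$-tensors. $\mathbb V^\wedge=\mathbb V^\otimes/\ker A_\sigma\leftrightarrow\mathrm{im}A_\sigma$ (equivalently the quotient of $\mathbb V^\otimes$ by the ideal generated by $\mathrm{im}(I+\tau)$), and $\mathbb V_\Sigma^\wedge\leftrightarrow\Sigma\otimes\mathbb V^\wedge$ is the analogous algebra for $\mathbb V_\Sigma$. The structures $\circ,\varkappa$ extend multiplicatively to it. $\mathrm{cl}[\mathbb V,g,\sigma,\Sigma]$ is the space $\mathbb V_\Sigma^\wedge$ with the Clifford product $\tilde m=m(\mathrm{id}\otimes g_\wedge\otimes\mathrm{id})(\phi_\wedge\otimes\phi_\wedge)$, where $m$ is the exterior product, $\phi_\wedge$ the deconcatenation coproduct on $\mathrm{im}A_\sigma$, and $g_\wedge(\psi,\xi)=g(\psi,A_\sigma\xi)$ with $g((\psi\otimes x)\otimes(y\otimes\xi))=g(\psi,g(x,y)\xi)$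 and different degrees orthogonal. In particular the Clifford product of $x,y\in\mathbb V$ is $x\wedge y+g(x,y)$. **Frame structure.** $\mathrm{hor}_P=\mathcal B\otimes\mathbb V^\wedge$ with $(q\otimes\vartheta)(b\otimes\eta)=\sum_kqb_k\otimes(\vartheta\circ c_k)\eta$ and $(b\otimes\vartheta)^*=\sum_kb_k^*\otimes(\vartheta^*\circ c_k^* )$ (graded $*$); $F^\wedge$ is the product coaction of $F$ and $\varkappa$. $\nabla:\mathrm{hor}_P\to\mathrm{hor}_P$ is a degree-one hermitian graded antiderivation intertwining $F^\wedge$, vanishing on the subalgebra generated by $\nabla(\mathcal V)$ and $1\otimes\mathbb V^\wedge$, and there are linear maps $b_\alpha:\mathbb V\to\mathcal B$ and elements $f_\alpha\in\mathcal V$ (finitely many) with $1\otimes\theta=\sum_\alpha b_\alpha(\theta)\nabla(f_\alpha)$ and $F[b_\alpha(\theta)]=(b_\alpha\otimes\mathrm{id})\varkappa(\theta)$. The maps $\partial_i:\mathcal B\to\mathcal B$ are defined by $\nabla(b)=\sum_i\partial_i(b)\otimes\theta_i$. The curvature $\varrho_\nabla$ is the linear map from $\mathcal A$ to the degree-two part of the graded commutant in $\mathrm{hor}_P$ of the $F^\wedge$-invariant subalgebra, determined by $\nabla^2(b)=-\sum_kb_k\varrho_\nabla(c_k)$. **Spinors.** $\mathbb S$ is a finite-dimensional Hilbert space with an irreducible $*$-representation $\gamma:\mathrm{cl}[\mathbb V,g,\sigma,\Sigma]\to B(\mathbb S)$ and a unitary representation $\varkappa_{\mathbb S}:\mathbb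 S\to\mathbb S\otimes\mathcal A$ such that $\varkappa_{\mathbb S}(Z\xi)=\varkappa(Z)\varkappa_{\mathbb S}(\xi)$ for all Clifford elements $Z$ and $\xi\in\mathbb S$. $\mathcal S=\mathcal B\otimes\mathbb S$ carries the product coaction $F_{\mathcal S}$ of $F$ and $\varkappa_{\mathbb S}$, and $\mathcal S_M=\{\psi\in\mathcal S:F_{\mathcal S}(\psi)=\psi\otimes1\}$.
   Formalization: The correspondence R̂ ↔ ∇² is proved with a minus sign: R̂ is the Cliffordization of −∇², i.e. of the curvature b ↦ Σ b_k ϱ_∇(c_k); with the literal plus sign the formula D² = Δ_S + R̂ fails for nonzero curvature (e.g. the classical sphere). *)

(* Defs.v *)
From HB Require Import structures.
From mathcomp Require Import all_boot all_order all_algebra perm generic_quotient.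
From mathcomp Require Import boolp classical_sets reals topology normedtype.
From mathcomp Require Import sequences.
From mathcomp Require Export complex.

Set Implicit Arguments.
Unset Strict Implicit.
Unset Printing Implicit Defensive.

Import Order.TTheory GRing.Theory Num.Theory.
Import numFieldNormedType.Exports.
Local Open Scope ring_scope.

(* [free P] is the vector space generated by the set X and universal for the
   maps f : X -> U satisfying P: two formal linear combinations of elements of
   X are identified when all such f send them to the same value.  The tensor
   product, the tensor algebra and quotient spaces are all of this form. *)
Section Free.
Variables (C : fieldType) (X : choiceType).
Variable P : forall U : lmodType C, (X -> U) -> Prop.

Definition fsum (U : lmodType C) (f : X -> U) (s : seq (C * X)) : U :=
  \sum_(p <- s) p.1 *: f p.2.

Definition frel (s t : seq (C * X)) : bool :=
  `[< forall (U : lmodType C) (f : X -> U), P f -> fsum f s = fsum f t >].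

Lemma frelP s t :
  reflect (forall (U : lmodType C) (f : X -> U), P f -> fsum f s = fsum f t)
          (frel s t).
Proof. exact: asboolP. Qed.

Lemma frel_refl : reflexive frel.
Proof. by move=> s; apply/frelP. Qed.

Lemma frel_sym : symmetric frel.
Proof. by move=> s t; apply/frelP/frelP => H U f Pf; rewrite (H U f Pf). Qed.

Lemma frel_trans : transitive frel.
Proof.
move=> t s r /frelP H1 /frelP H2; apply/frelP => U f Pf.
by rewrite (H1 U f Pf) (H2 U f Pf).
Qed.

Canonical frel_equiv := EquivRel frel frel_refl frel_sym frel_trans.

Definition free := {eq_quot frel_equiv}%qT.
HB.instance Definition _ := Choice.on free.

Definition free_cls (s : seq (C * X)) : free := (\pi_free s)%qT.
Definition gen (x : X) : free := free_cls [:: (1, x)].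

(* the linear map induced by f on the quotient, when f satisfies P *)
Definition flift (U : lmodType C) (f : X -> U) (z : free) : U :=
  fsum f (repr z).

Lemma free_clsP s t :
  free_cls s = free_cls t <->
  forall (U : lmodType C) (f : X -> U), P f -> fsum f s = fsum f t.
Proof.
split=> [/eqquotP/frelP //|H]; apply/eqquotP; exact/frelP.
Qed.

Lemma flift_cls (U : lmodType C) (f : X -> U) s :
  P f -> flift f (free_cls s) = fsum f s.
Proof. by move=> Pf; apply: (free_clsP _ _).1 => //; exact: reprK. Qed.

Lemma free_eqP (x y : free) :
  x = y <->
  forall (U : lmodType C) (f : X -> U), P f -> flift f x = flift f y.
Proof.
split=> [-> //|H]; rewrite -[x]reprK -[y]reprK; apply/free_clsP => U f Pf.
exact: H.
Qed.

Lemma fsum_cat (U : lmodType C) (f : X -> U) s t :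
  fsum f (s ++ t) = fsum f s + fsum f t.
Proof. by rewrite /fsum big_cat. Qed.

Lemma fsum_scale (U : lmodType C) (f : X -> U) a s :
  fsum f [seq (a * p.1, p.2) | p <- s] = a *: fsum f s.
Proof.
rewrite /fsum big_map scaler_sumr; apply: eq_bigr => p _.
by rewrite scalerA.
Qed.

Definition free0 : free := free_cls [::].
Definition free_add (x y : free) : free := free_cls (repr x ++ repr y).
Definition free_scale (a : C) (x : free) : free :=
  free_cls [seq (a * p.1, p.2) | p <- repr x].
Definition free_opp (x : free) : free := free_scale (-1) x.

Lemma flift0 (U : lmodType C) (f : X -> U) : P f -> flift f free0 = 0.
Proof. by move=> Pf; rewrite flift_cls // /fsum big_nil. Qed.

Lemma fliftD (U : lmodType C) (f : X -> U) x y :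
  P f -> flift f (free_add x y) = flift f x + flift f y.
Proof. by move=> Pf; rewrite flift_cls // fsum_cat. Qed.

Lemma fliftZ (U : lmodType C) (f : X -> U) a x :
  P f -> flift f (free_scale a x) = a *: flift f x.
Proof. by move=> Pf; rewrite flift_cls // fsum_scale. Qed.

Lemma free_addA : associative free_add.
Proof. by move=> x y z; apply/free_eqP => U f Pf; rewrite !fliftD // addrA. Qed.

Lemma free_addC : commutative free_add.
Proof. by move=> x y; apply/free_eqP => U f Pf; rewrite !fliftD // addrC. Qed.

Lemma free_add0 : left_id free0 free_add.
Proof.
by move=> x; apply/free_eqP => U f Pf; rewrite fliftD // flift0 // add0r.
Qed.

Lemma free_addN : left_inverse free0 free_opp free_add.
Proof.
move=> x; apply/free_eqP => U f Pf.
by rewrite fliftD // fliftZ // flift0 // scaleN1r addNr.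
Qed.

HB.instance Definition _ :=
  GRing.isZmodule.Build free free_addA free_addC free_add0 free_addN.

Lemma free_scaleA a b (x : free) :
  free_scale a (free_scale b x) = free_scale (a * b) x.
Proof. by apply/free_eqP => U f Pf; rewrite !fliftZ // scalerA. Qed.

Lemma free_scale1 : left_id 1 free_scale.
Proof. by move=> x; apply/free_eqP => U f Pf; rewrite fliftZ // scale1r. Qed.

Lemma free_scaleDr : right_distributive free_scale +%R.
Proof.
move=> a x y; apply/free_eqP => U f Pf.
by rewrite fliftZ // !fliftD // !fliftZ // scalerDr.
Qed.

Lemma free_scaleDl (x : free) : {morph free_scale^~ x : a b / a + b}.
Proof.
move=> a b; apply/free_eqP => U f Pf.
by rewrite fliftD // !fliftZ // scalerDl.
Qed.

HB.instance Definition _ :=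
  GRing.Zmodule_isLmodule.Build C free
    free_scaleA free_scale1 free_scaleDr free_scaleDl.

Lemma flift_gen (U : lmodType C) (f : X -> U) x : P f -> flift f (gen x) = f x.
Proof. by move=> Pf; rewrite flift_cls // /fsum big_seq1 scale1r. Qed.

Lemma flift_linear (U : lmodType C) (f : X -> U) : P f -> linear (flift f).
Proof. by move=> Pf a x y; rewrite fliftD // fliftZ. Qed.

End Free.

(* the antilinear counterpart of [flift] *)
Definition alift (C : numClosedFieldType) (X : choiceType)
    (P : forall U : lmodType C, (X -> U) -> Prop)
    (U : lmodType C) (f : X -> U) (z : free P) : U :=
  \sum_(p <- repr z) (p.1)^* *: f p.2.

Section Bilinear.
Variable C : numClosedFieldType.

Definition bilinear_map (U V W : lmodType C) (f : U -> V -> W) : Prop :=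
  (forall v, linear (f^~ v)) /\ (forall u, linear (f u)).

Definition antilinear_map (U V : lmodType C) (f : U -> V) : Prop :=
  forall a x y, f (a *: x + y) = a^* *: f x + f y.

End Bilinear.

Section Tensor.
Variable C : numClosedFieldType.

Definition tens (V W : lmodType C) : lmodType C :=
  free (fun (U : lmodType C) (f : V * W -> U) =>
          bilinear_map (fun v w => f (v, w))).

Definition tpure (V W : lmodType C) (v : V) (w : W) : tens V W := gen _ (v, w).

Definition tlift (V W U : lmodType C) (f : V -> W -> U) (z : tens V W) : U :=
  flift (fun p => f p.1 p.2) z.

Definition talift (V W U : lmodType C) (f : V -> W -> U) (z : tens V W) : U :=
  alift (fun p => f p.1 p.2) z.

End Tensor.

Notation "x '\ot' y" := (tpure x y) (at level 40, left associativity).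

(* [sw (x, y) := t in E] is the sum of E over the terms of t = \sum x \ot y,
   E being bilinear in (x, y); [asw] is the same for E antilinear in x and in
   y. *)
Notation "'sw' ( x , y ) ':=' t 'in' E" := (tlift (fun x y => E) t)
  (at level 200, x name, y name, t at level 100, E at level 200).
Notation "'asw' ( x , y ) ':=' t 'in' E" := (talift (fun x y => E) t)
  (at level 200, x name, y name, t at level 100, E at level 200).

Section TensorMaps.
Variable C : numClosedFieldType.

Definition tmap (V W V' W' : lmodType C) (f : V -> V') (g : W -> W')
    (z : tens V W) : tens V' W' :=
  sw (x, y) := z in f x \ot g y.

Definition tassoc (U V W : lmodType C) (z : tens (tens U V) W) :
    tens U (tens V W) :=
  sw (t, w) := z in sw (u, v) := t in u \ot (v \ot w).

(* (m \ot a, n \ot b) |-> f m n \ot ab *)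
Definition tprod (A : algType C) (M N L : lmodType C) (f : M -> N -> L)
    (z : tens M A) (w : tens N A) : tens L A :=
  sw (m, a) := z in sw (n, b) := w in f m n \ot (a * b).

Definition pcoact (A : algType C) (U W : lmodType C)
    (alpha : U -> tens U A) (beta : W -> tens W A) (z : tens U W) :
    tens (tens U W) A :=
  sw (u, w) := z in
  tprod (fun u' w' => (u' \ot w' : tens U W)) (alpha u) (beta w).

End TensorMaps.

Section StarAlgebras.
Variable C : numClosedFieldType.

Record starAlg := StarAlg {
  sa_alg :> algType C;
  star : sa_alg -> sa_alg;
  star_antilinear : antilinear_map star;
  starK : involutive star;
  starM : forall a b, star (a * b) = star b * star a }.

Definition tstar (A B : starAlg) (z : tens A B) : tens A B :=
  asw (a, b) := z in star a \ot star b.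

Definition is_star_hom (A B : starAlg) (f : A -> B) : Prop :=
  [/\ linear f, f 1 = 1, {morph f : x y / x * y} &
      forall x, f (star x) = star (f x)].

Definition is_tstar_hom (D A B : starAlg) (f : D -> tens A B) : Prop :=
  [/\ linear f, f 1 = 1 \ot 1,
      forall x y, f (x * y) = tprod (fun a b => a * b) (f x) (f y) &
      forall x, f (star x) = tstar (f x)].

Definition star_generated (A : starAlg) (S : A -> Prop) : Prop :=
  forall Q : A -> Prop,
    Q 1 -> (forall k x y, Q x -> Q y -> Q (k *: x + y)) ->
    (forall x y, Q x -> Q y -> Q (x * y)) ->
    (forall x, Q x -> Q (star x)) ->
    (forall x, S x -> Q x) -> forall x, Q x.

End StarAlgebras.

(* Compact matrix quantum groups, through the Hopf *-algebra generated by the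
   matrix coefficients of a unitary fundamental corepresentation. *)
Record cmqg (C : numClosedFieldType) := Cmqg {
  pol :> starAlg C;
  coprod : pol -> tens pol pol;
  counit : pol -> C;
  antip : pol -> pol;
  coprod_hom : is_tstar_hom coprod;
  coprodA : forall a,
    tassoc (tmap coprod id (coprod a)) = tmap id coprod (coprod a);
  counit_linear : forall k a b, counit (k *: a + b) = k * counit a + counit b;
  counit1 : counit 1 = 1;
  counitM : forall a b, counit (a * b) = counit a * counit b;
  counit_star : forall a, counit (star a) = (counit a)^*;
  counitl : forall a, (sw (a1, a2) := coprod a in counit a1 *: a2) = a;
  counitr : forall a, (sw (a1, a2) := coprod a in counit a2 *: a1) = a;
  antip_linear : linear antip;
  antipl : forall a,
    (sw (a1, a2) := coprod a in antip a1 * a2) = counit a *: 1;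
  antipr : forall a,
    (sw (a1, a2) := coprod a in a1 * antip a2) = counit a *: 1;
  fundamental : exists (n : nat) (u : 'M[pol]_n),
    [/\ forall i j, coprod (u i j) = \sum_k u i k \ot u k j,
        forall i j, \sum_k u i k * star (u j k) = (i == j)%:R,
        forall i j, \sum_k star (u k i) * u k j = (i == j)%:R &
        star_generated (fun a => exists i j, a = u i j)] }.

Section Modules.
Variables (C : numClosedFieldType) (G : cmqg C).

Definition is_coaction (M : lmodType C) (alpha : M -> tens M G) : Prop :=
  [/\ linear alpha,
      forall m, tassoc (tmap alpha id (alpha m)) = tmap id (@coprod _ G) (alpha m) &
      forall m, (sw (x, c) := alpha m in counit c *: x) = m].

Definition is_rmodule (M : lmodType C) (op : M -> G -> M) : Prop :=
  [/\ bilinear_map op, forall m, op m 1 = m &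
      forall m a b, op (op m a) b = op m (a * b)].

End Modules.

Record qpb (C : numClosedFieldType) (G : cmqg C) := Qpb {
  base : starAlg C;
  total : starAlg C;
  incl : base -> total;
  coact : total -> tens total G;
  incl_hom : is_star_hom incl;
  incl_inj : injective incl;
  coact_hom : is_tstar_hom coact;
  coact_coaction : is_coaction coact;
  base_invariant : forall b, (exists f, b = incl f) <-> coact b = b \ot 1;
  coact_free : forall z : tens total G, exists s : seq (total * total),
    z = \sum_(p <- s) tprod (fun q b => q * b) (p.1 \ot 1) (coact p.2) }.

Arguments coact {C G} P _ : rename.
Arguments incl {C G} P _ : rename.

Record coordSpace (C : numClosedFieldType) (G : cmqg C) := CoordSpace {
  coord_vect :> vectType C;
  vstar : coord_vect -> coord_vect;
  vcirc : coord_vect -> G -> coord_vect;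
  vkap : coord_vect -> tens coord_vect G;
  cdim : nat;
  cbasis : cdim.-tuple coord_vect;
  vstar_antilinear : antilinear_map vstar;
  vstarK : involutive vstar;
  vcirc_module : is_rmodule vcirc;
  vkap_coaction : is_coaction vkap;
  vkap_star : forall x,
    vkap (vstar x) = (asw (y, c) := vkap x in vstar y \ot star c);
  vcirc_star : forall x a,
    vstar (vcirc x a) = vcirc (vstar x) (star (antip a));
  vkap_circ : forall x a,
    vkap (vcirc x a) =
      (sw (a1, a') := coprod a in sw (a2, a3) := coprod a' in
       sw (y, c) := vkap x in vcirc y a2 \ot (antip a1 * c * a3));
  cbasisP : basis_of fullv cbasis }.

Arguments vstar {C G} V _ : rename.
Arguments vcirc {C G} V _ _ : rename.
Arguments vkap {C G} V _ : rename.

Definition theta (C : numClosedFieldType) (G : cmqg C) (V : coordSpace G)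
  (i : 'I_(cdim V)) : V := tnth (cbasis V) i.

(* A map on words of vectors that is linear in each letter is the same thing as
   a linear map on the tensor algebra (the empty word spanning degree zero). *)
Section TensorAlgebra.
Variables (C : numClosedFieldType) (V : lmodType C).

Definition letterwise_linear (U : lmodType C) (f : seq V -> U) : Prop :=
  forall l r, linear (fun x => f (l ++ x :: r)).

Definition talg : lmodType C := free letterwise_linear.

Definition tword (w : seq V) : talg := gen _ w.

Definition tcat (s t : talg) : talg :=
  flift (fun u => flift (fun v => tword (u ++ v)) t) s.

Definition tdeg (n : nat) (t : talg) : talg :=
  flift (fun w => if size w == n then tword w else 0) t.

Definition emb2 (z : tens V V) : talg := sw (x, y) := z in tword [:: x; y].

(* id^{\otimes i} \otimes s \otimes id, extended by the identity in degrees
   smaller than i + 2 *)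
Definition op_at (s : tens V V -> tens V V) (i : nat) (t : talg) : talg :=
  flift (fun w => match drop i w with
    | x :: y :: r =>
        sw (x', y') := s (x \ot y) in tword (take i w ++ x' :: y' :: r)
    | _ => tword w
    end) t.

Inductive tideal (K : talg -> Prop) : talg -> Prop :=
| tideal_gen t : K t -> tideal K t
| tideal0 : tideal K 0
| tideal_lin k s t : tideal K s -> tideal K t -> tideal K (k *: s + t)
| tideal_mul l t r : tideal K t -> tideal K (tcat l (tcat t r)).

Definition deconcat (t : talg) : tens talg talg :=
  flift (fun w => \sum_(k < (size w).+1)
           tword (take k w) \ot tword (drop k w)) t.

End TensorAlgebra.

Section Antisymmetrizer.

Definition inversions n (p : 'S_n) : nat :=
  #|[set ij : 'I_n * 'I_n | (ij.1 < ij.2)%N && (p ij.2 < p ij.1)%N]|.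

(* the transposition (i i+1), and 1 for the last index *)
Definition adjacent n (i : 'I_n) : 'S_n := tperm i (odflt i (insub i.+1)).

Definition reduced_word n (p : 'S_n) : seq 'I_n :=
  if [pick w : (inversions p).-tuple 'I_n |
      (\prod_(i <- w) adjacent i)%g == p] is Some w then w : seq 'I_n
  else [::].

Variables (C : numClosedFieldType) (V : lmodType C).
Variable sigma : tens V V -> tens V V.

(* By the braid equation this does not depend on the reduced word. *)
Definition sigma_perm n (p : 'S_n) (t : talg V) : talg V :=
  foldr (fun (i : 'I_n) u => op_at sigma i u) t (reduced_word p).

Definition antisym (t : talg V) : talg V :=
  flift (fun w => \sum_(p : 'S_(size w))
           (-1) ^+ inversions p *: sigma_perm p (tword w)) t.

End Antisymmetrizer.

Section ExteriorAlgebra.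
Variables (C : numClosedFieldType).

Definition quo (M : lmodType C) (K : M -> Prop) : lmodType C :=
  free (fun (U : lmodType C) (f : M -> U) =>
          linear f /\ forall x, K x -> f x = 0).

Variables (V : lmodType C) (sigma : tens V V -> tens V V).

Definition ext : lmodType C := quo (fun t => antisym sigma t = 0).

Definition wcls (t : talg V) : ext := gen _ t.

Definition wmul (p q : ext) : ext :=
  flift (fun s => flift (fun t => wcls (tcat s t)) q) p.

(* the identification of ext with the image of the antisymmetrizer *)
Definition wanti (p : ext) : talg V := flift (antisym sigma) p.

(* a linear left inverse of wanti *)
Definition wret : talg V -> ext :=
  xget (fun _ => 0)
       [set r | linear r /\ forall p : ext, r (wanti p) = p]%classic.

(* The restriction of deconcatenation to im A, A being the antisymmetrizer.
   Deconcatenation maps im A to im A \otimes im A, on which wret \otimes wret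
   is the inverse of wanti \otimes wanti whatever the choice of wret. *)
Definition wcoprod (p : ext) : tens ext ext :=
  tmap wret wret (deconcat (wanti p)).

End ExteriorAlgebra.

Section TensorAlgebraStructures.
Variables (C : numClosedFieldType) (G : cmqg C) (V : coordSpace G).

Definition tau (z : tens V V) : tens V V :=
  sw (x, y) := z in sw (y', c) := vkap V y in y' \ot vcirc V x c.

Fixpoint circ_word (w : seq V) (a : G) : talg V :=
  match w with
  | [::] => counit a *: tword [::]
  | x :: w' => sw (a1, a2) := coprod a in
      tcat (tword [:: vcirc V x a1]) (circ_word w' a2)
  end.

Definition tcirc (t : talg V) (a : G) : talg V :=
  flift (fun w => circ_word w a) t.

Fixpoint kap_word (w : seq V) : tens (talg V) G :=
  match w with
  | [::] => tword [::] \ot 1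
  | x :: w' => tprod (fun y u => tcat (tword [:: y]) u) (vkap V x) (kap_word w')
  end.

Definition tkap (t : talg V) : tens (talg V) G := flift kap_word t.

Definition tastar (t : talg V) : talg V :=
  alift (fun w => tword (rev (map (vstar V) w))) t.

(* the star operation with (x y)^* = (-1)^{|x||y|} y^* x^* *)
Definition tgstar (t : talg V) : talg V :=
  alift (fun w => (-1) ^+ 'C(size w, 2) *:
                    tword (rev (map (vstar V) w))) t.

End TensorAlgebraStructures.

Section MetricConstructions.
Variables (C : numClosedFieldType) (G : cmqg C) (V : coordSpace G).
Variables (Sg : starAlg C) (h : Sg -> 'M[Sg]_(cdim V)).
Variable (g : tens V V -> Sg).

(* the twisting \theta_i s = \sum_j h(s)_{ij} \theta_j *)
Definition twist (x : V) (s : Sg) : tens Sg V :=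
  \sum_i coord (cbasis V) i x *: \sum_j (h s i j \ot theta j).

Fixpoint twist_word (w : seq V) (s : Sg) : tens Sg (talg V) :=
  match w with
  | [::] => s \ot tword [::]
  | x :: w' => sw (s', u) := twist_word w' s in
               sw (s'', y) := twist x s' in s'' \ot tcat (tword [:: y]) u
  end.

Definition ttwist (t : talg V) (s : Sg) : tens Sg (talg V) :=
  flift (fun w => twist_word w s) t.

(* g(u x, y v) = g(u, g(x, y) v) = g(u g(x, y), v) *)
Fixpoint g_word (v : seq V) (t : talg V) : Sg :=
  match v with
  | [::] => flift (fun u => if u is [::] then 1 else 0 : Sg) t
  | y :: v' => flift (fun u => match rev u with
      | [::] => 0 : Sg
      | x :: ru => sw (s, u') := twist_word (rev ru) (g (x \ot y)) in
                   s * g_word v' u'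
      end) t
  end.

Definition tg (t t' : talg V) : Sg := flift (fun v => g_word v t) t'.

(* The tensor algebra of V_\Sigma is identified with Sg \otimes talg V. *)
Definition sstar (z : tens Sg (talg V)) : tens Sg (talg V) :=
  asw (s, t) := z in ttwist (tastar t) (star s).

Definition sg (z w : tens Sg (talg V)) : Sg :=
  sw (s, t) := z in sw (s', t') := w in
  sw (s'', u) := ttwist t s' in s * s'' * tg u t'.

Definition sip (z w : tens Sg (talg V)) : Sg := sg (sstar z) w.

Definition gg (t : talg V) : Sg :=
  flift (fun w => if w is [:: x; y; z; t] then g (x \ot y) * g (z \ot t)
                  else 0 : Sg) t.

Definition gmatrix : 'M[Sg]_(cdim V) :=
  \matrix_(i, j) g (theta i \ot theta j).

Section Clifford.
Variable sigma : tens V V -> tens V V.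
Let W := ext sigma.

Definition wcirc (p : W) (a : G) : W := flift (fun t => wcls sigma (tcirc t a)) p.
Definition wkap (p : W) : tens W G :=
  flift (fun t => tmap (wcls sigma) id (tkap t)) p.
Definition wastar (p : W) : W := alift (fun t => wcls sigma (tastar t)) p.
Definition wgstar (p : W) : W := alift (fun t => wcls sigma (tgstar t)) p.
Definition wtwist (p : W) (s : Sg) : tens Sg W :=
  flift (fun t => tmap id (wcls sigma) (ttwist t s)) p.

Definition wg (p q : W) : Sg :=
  flift (fun t => flift (fun t' => tg t (antisym sigma t')) q) p.

Definition cl : lmodType C := tens Sg W.

(* m (id \otimes g_\wedge \otimes id) (\phi_\wedge \otimes \phi_\wedge) on
   V^\wedge; the value of g_\wedge is moved to the left by the twisting *)
Definition clmul_pure (p q : W) : cl :=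
  sw (p1, p2) := wcoprod p in sw (q1, q2) := wcoprod q in
  sw (s, p1') := wtwist p1 (wg p2 q1) in s \ot wmul p1' q2.

Definition clmul (z w : cl) : cl :=
  sw (s, p) := z in sw (s', q) := w in sw (s'', p') := wtwist p s' in
  sw (r, e) := clmul_pure p' q in (s * s'' * r) \ot e.

Definition cl1 : cl := 1 \ot wcls sigma (tword [::]).

Definition clstar (z : cl) : cl :=
  asw (s, p) := z in wtwist (wastar p) (star s).

End Clifford.
End MetricConstructions.

Section SquareSummable.
Variable C : numClosedFieldType.
Implicit Types x y : int -> C.

Definition l2sum x (n : nat) : C :=
  \sum_(0 <= k < n) (`|x (Posz k)| ^+ 2 + `|x (Negz k)| ^+ 2).

Definition l2 x : Prop := exists M, forall n, l2sum x n <= M.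

Definition l2ip x y : C :=
  (limn (series (fun k => (x (Posz k))^* * y (Posz k)
                          + (x (Negz k))^* * y (Negz k))))%classic.

(* a faithful realization of a unital *-algebra by operators on a common
   invariant dense domain *)
Record l2real (Sg : starAlg C) := L2real {
  dom : (int -> C) -> Prop;
  opr : Sg -> (int -> C) -> (int -> C);
  dom_l2 : forall x, dom x -> l2 x;
  dom0 : dom (fun _ => 0);
  dom_lin : forall k x y, dom x -> dom y -> dom (fun n => k * x n + y n);
  dom_dense : forall x (e : C), l2 x -> 0 < e ->
    exists2 y, dom y & forall n, l2sum (fun k => x k - y k) n <= e;
  opr_dom : forall a x, dom x -> dom (opr a x);
  opr_lin : forall a k x y, dom x -> dom y ->
    opr a (fun n => k * x n + y n) = fun n => k * opr a x n + opr a y n;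
  opr_alg_lin : forall k a b x, dom x ->
    opr (k *: a + b) x = fun n => k * opr a x n + opr b x n;
  opr1 : forall x, dom x -> opr 1 x = x;
  oprM : forall a b x, dom x -> opr (a * b) x = opr a (opr b x);
  opr_star : forall a x y, dom x -> dom y ->
    l2ip (opr (star a) x) y = l2ip x (opr a y);
  opr_faithful : forall a, (forall x, dom x -> opr a x = fun _ => 0) -> a = 0 }.

Definition op_pos (Sg : starAlg C) (r : l2real Sg) (a : Sg) : Prop :=
  forall x, dom r x -> 0 <= l2ip x (opr r a x).

End SquareSummable.

Record qmetric (C : numClosedFieldType) (G : cmqg C) (V : coordSpace G) :=
  QMetric {
  sigma : tens V V -> tens V V;
  sigmaV : tens V V -> tens V V;
  Sig : starAlg C;
  met : tens V V -> Sig;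
  twh : Sig -> 'M[Sig]_(cdim V);
  sreal : l2real Sig;
  scirc : Sig -> G -> Sig;
  skap : Sig -> tens Sig G;
  sigma_linear : linear sigma;
  sigmaK : cancel sigma sigmaV;
  sigmaVK : cancel sigmaV sigma;
  sigma_braid : forall x y z : V,
    op_at sigma 0 (op_at sigma 1 (op_at sigma 0 (tword [:: x; y; z]))) =
    op_at sigma 1 (op_at sigma 0 (op_at sigma 1 (tword [:: x; y; z])));
  sigma_star : forall x y : V,
    tastar (emb2 (sigma (x \ot y))) = emb2 (sigma (vstar V y \ot vstar V x));
  sigma_circ : forall (x y : V) a,
    tcirc (emb2 (sigma (x \ot y))) a =
    op_at sigma 0 (tcirc (tword [:: x; y]) a);
  sigma_kap : forall x y : V,
    tkap (emb2 (sigma (x \ot y))) =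
    tmap (op_at sigma 0) id (tkap (tword [:: x; y]));
  met_linear : linear met;
  met_sigma : forall z, met (sigma z) = met z;
  met_star : forall x y, star (met (x \ot y)) = met (vstar V y \ot vstar V x);
  met_invertible_generates : exists gV : 'M[Sig]_(cdim V),
    [/\ gmatrix met *m gV = 1%:M, gV *m gmatrix met = 1%:M &
        star_generated (fun a => (exists i j, a = gmatrix met i j) \/
                                 (exists i j, a = gV i j))];
  twh_linear : forall i j, linear (fun s => twh s i j);
  twh1 : twh 1 = 1%:M;
  twhM : forall s t, twh (s * t) = twh s *m twh t;
  twist_met : forall x y z : V,
    twist twh x (met (y \ot z)) =
      (sw (y', x') := sigmaV (x \ot y) in sw (z', x'') := sigma (x' \ot z) in
       met (y' \ot z') \ot x'');
  gg_sigma : forall x y z t : V, let w := tword [:: x; y; z; t] in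
    gg met w = gg met (op_at sigma 1 (op_at sigmaV 0 (op_at sigma 2
                        (op_at sigmaV 1 w)))) /\
    gg met w = gg met (op_at sigma 1 (op_at sigma 0 (op_at sigmaV 2
                        (op_at sigmaV 1 w))));
  (* V_\Sigma is the degree one part of Sig \otimes talg V *)
  met_pos : forall z : tens Sig (talg V), tmap id (tdeg 1) z = z ->
    op_pos sreal (sip twh met z z) /\ (sip twh met z z = 0 -> z = 0);
  scirc_module : is_rmodule scirc;
  scirc1 : forall a, scirc 1 a = counit a *: 1;
  scircM : forall s t a,
    scirc (s * t) a = (sw (a1, a2) := coprod a in scirc s a1 * scirc t a2);
  scirc_met : forall (x y : V) a,
    scirc (met (x \ot y)) a =
      (sw (a1, a2) := coprod a in met (vcirc V x a1 \ot vcirc V y a2));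
  skap_coaction : is_coaction skap;
  skap1 : skap 1 = 1 \ot 1;
  skapM : forall s t, skap (s * t) = tprod (fun a b => a * b) (skap s) (skap t);
  skap_met : forall z, skap (met z) =
    tmap met id (pcoact (vkap V) (vkap V) z);
  antisym_pos : forall n (z : tens Sig (talg V)), tmap id (tdeg n) z = z ->
    op_pos sreal (sip twh met z (tmap id (antisym sigma) z));
  antisym_im : forall n (t : talg V), tdeg n t = t ->
    (exists u, tdeg n u = u /\ t = antisym sigma u) <->
    (forall i, (i.+1 < n)%N -> op_at (@tau _ _ V) i t = - t);
  antisym_ker : forall t : talg V,
    antisym sigma t = 0 <->
    tideal (fun u => exists z, u = emb2 z + emb2 (tau z)) t;
  (* the module structure, the coaction, the twisting and the pairing
     g(t, A t') are well defined on the exterior algebra *)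
  ext_circ : forall (t : talg V) a,
    antisym sigma t = 0 -> antisym sigma (tcirc t a) = 0;
  ext_kap : forall t : talg V,
    antisym sigma t = 0 -> tmap (wcls sigma) id (tkap t) = 0;
  ext_twist : forall (t : talg V) s,
    antisym sigma t = 0 -> tmap id (wcls sigma) (ttwist twh t s) = 0;
  ext_met : forall t t' : talg V,
    antisym sigma t = 0 -> tg twh met t (antisym sigma t') = 0 }.

Arguments sigma {C G V} M _ : rename.
Arguments sigmaV {C G V} M _ : rename.
Arguments met {C G V} M _ : rename.
Arguments twh {C G V} M _ : rename.
Arguments scirc {C G V} M _ _ : rename.
Arguments skap {C G V} M _ : rename.

Section Horizontal.
Variables (C : numClosedFieldType) (G : cmqg C) (P : qpb G).
Variables (V : coordSpace G) (sigma : tens V V -> tens V V).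
Let B := total P.
Let W := ext sigma.

Definition hor : lmodType C := tens B W.

Definition hor_b (b : B) : hor := b \ot wcls sigma (tword [::]).
Definition hor_w (p : W) : hor := 1 \ot p.
Definition hor_v (x : V) : hor := hor_w (wcls sigma (tword [:: x])).

Definition hmul (z w : hor) : hor :=
  sw (q, p) := z in sw (b, e) := w in sw (b', c) := coact P b in
  (q * b') \ot wmul (wcirc p c) e.

Definition hstar (z : hor) : hor :=
  asw (b, p) := z in asw (b', c) := coact P b in
  star b' \ot wcirc (wgstar p) (star c).

Definition hcoact (z : hor) : tens hor G :=
  pcoact (coact P) (@wkap _ _ V sigma) z.

Definition hdeg (n : nat) (z : hor) : Prop :=
  exists y : tens B (talg V), z = tmap id (fun t => wcls sigma (tdeg n t)) y.

Inductive hsubalg (S : hor -> Prop) : hor -> Prop :=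
| hsub_gen z : S z -> hsubalg S z
| hsub1 : hsubalg S (hor_b 1)
| hsub_lin k y z : hsubalg S y -> hsubalg S z -> hsubalg S (k *: y + z)
| hsub_mul y z : hsubalg S y -> hsubalg S z -> hsubalg S (hmul y z).

End Horizontal.

Record frame (C : numClosedFieldType) (G : cmqg C) (P : qpb G)
    (V : coordSpace G) (sigma : tens V V -> tens V V) := Frame {
  nabla : hor P sigma -> hor P sigma;
  partial : 'I_(cdim V) -> total P -> total P;
  curv : G -> hor P sigma;
  nabla_linear : linear nabla;
  nabla_deg : forall n z, hdeg n z -> hdeg n.+1 (nabla z);
  nabla_mul : forall n y z, hdeg n y ->
    nabla (hmul y z) = hmul (nabla y) z + (-1) ^+ n *: hmul y (nabla z);
  nabla_star : forall z, nabla (hstar z) = hstar (nabla z);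
  nabla_coact : forall z, hcoact (nabla z) = tmap nabla id (hcoact z);
  nabla_vanish : forall z,
    hsubalg (fun y => (exists f : base P, y = nabla (hor_b sigma (incl P f))) \/
                      (exists p, y = hor_w P p)) z -> nabla z = 0;
  frame_decomposition :
    exists (I : finType) (beta : I -> V -> total P) (f : I -> base P),
    [/\ forall i, linear (beta i),
        forall x, hor_v P sigma x =
          \sum_i hmul (hor_b sigma (beta i x))
                      (nabla (hor_b sigma (incl P (f i)))) &
        forall i x, coact P (beta i x) = tmap (beta i) id (vkap V x)];
  partial_linear : forall i, linear (partial i);
  partialE : forall b,
    nabla (hor_b sigma b) =
    \sum_i partial i b \ot wcls sigma (tword [:: theta i]);
  curv_linear : linear curv;
  curv_deg : forall a, hdeg 2 (curv a);
  curv_commutant : forall a z,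
    hcoact z = z \ot 1 -> hmul z (curv a) = hmul (curv a) z;
  curvE : forall b,
    nabla (nabla (hor_b sigma b)) =
    - (sw (b', c) := coact P b in hmul (hor_b sigma b') (curv c)) }.

Arguments nabla {C G P V sigma} F _ : rename.
Arguments partial {C G P V sigma} F _ _ : rename.
Arguments curv {C G P V sigma} F _ : rename.

Record spinors (C : numClosedFieldType) (G : cmqg C) (V : coordSpace G)
    (M : qmetric V) := Spinors {
  spin :> vectType C;
  sdot : spin -> spin -> C;
  gam : cl (Sig M) (sigma M) -> 'End(spin);
  spkap : spin -> tens spin G;
  sdot_lin : forall x k y z, sdot x (k *: y + z) = k * sdot x y + sdot x z;
  sdot_herm : forall x y, sdot y x = (sdot x y)^*;
  sdot_pos : forall x, x != 0 -> 0 < sdot x x;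
  gam_linear : linear gam;
  gam1 : gam (cl1 _ _) = \1%VF;
  gamM : forall z w,
    gam (clmul (twh M) (met M) z w) = (gam z \o gam w)%VF;
  gam_star : forall z x y,
    sdot (gam (clstar (twh M) z) x) y = sdot x (gam z y);
  gam_irr : (fullv : {vspace spin}) != 0%VS /\
    forall U : {vspace spin}, (forall z, (gam z @: U <= U)%VS) ->
      U = 0%VS \/ U = fullv;
  spkap_coaction : is_coaction spkap;
  spkap_unitary : forall x y,
    (asw (x', c) := spkap x in sw (y', c') := spkap y in
       sdot x' y' *: (star c * c')) = sdot x y *: 1;
  spkap_gam : forall z x,
    spkap (gam z x) =
    tprod (fun (z' : cl _ _) x' => gam z' x')
          (pcoact (skap M) (@wkap _ _ V (sigma M)) z) (spkap x) }.

Arguments gam {C G V M} S _ : rename.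
Arguments spkap {C G V M} S _ : rename.
Arguments sdot {C G V M} S _ _ : rename.

Section Dirac.
Variables (C : numClosedFieldType) (G : cmqg C) (P : qpb G).
Variables (V : coordSpace G) (M : qmetric V) (F : frame P (sigma M)).
Variable S : spinors M.

Definition spinor_fields : lmodType C := tens (total P) S.

Definition in_SM (psi : spinor_fields) : Prop :=
  pcoact (coact P) (spkap S) psi = psi \ot 1.

Definition cl_of_ext (p : ext (sigma M)) : cl (Sig M) (sigma M) := 1 \ot p.
Definition cl_of_scalar (s : Sig M) : cl (Sig M) (sigma M) :=
  s \ot wcls (sigma M) (tword [::]).

Definition dirac (psi : spinor_fields) : spinor_fields :=
  - 'i *: \sum_j tmap (partial F j)
                      (gam S (cl_of_ext (wcls (sigma M) (tword [:: theta j])))) psi.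

Definition spin_laplacian (psi : spinor_fields) : spinor_fields :=
  - \sum_i \sum_j tmap (fun b => partial F i (partial F j b))
                       (gam S (cl_of_scalar (gmatrix (met M) i j))) psi.

(* The operator b \otimes x |-> \sum_k b_k \otimes \gamma(p_k) x, where
   T b = \sum_k b_k \otimes p_k and the exterior forms p_k are regarded as
   elements of the Clifford algebra. *)
Definition cliffordization (T : total P -> hor P (sigma M))
    (psi : spinor_fields) : spinor_fields :=
  sw (b, x) := psi in sw (b', p) := T b in b' \ot gam S (cl_of_ext p) x.

Definition nabla2 (b : total P) : hor P (sigma M) :=
  nabla F (nabla F (hor_b (sigma M) b)).

(* b |-> \sum_k b_k \varrho(c_k) *)
Definition curvature_operator (b : total P) : hor P (sigma M) :=
  sw (b', c) := coact P b in hmul (hor_b (sigma M) b') (curv F c).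

(* As nabla^2(b) = - \sum_k b_k \varrho(c_k), this is the Cliffordization of the
   curvature \varrho, hence of - nabla^2. *)
Definition Rhat : spinor_fields -> spinor_fields :=
  cliffordization curvature_operator.

End Dirac.

(* Main.v *)
(* Everything is multilinear, so the identities can be checked on b \ot x.  As
   nabla vanishes on the forms 1 \ot w, the graded Leibniz rule gives
     nabla^2 b = \sum_jk d_k d_j b \ot (theta_k /\ theta_j),
   while the Clifford relation
     theta_k theta_j = theta_k /\ theta_j + g_kj
   splits D^2 (b \ot x) = - \sum_jk d_k d_j b \ot gamma (theta_k theta_j) x into
   the Laplacian and the Cliffordization of - nabla^2.  Equivariance is inherited
   from nabla: the Cliffordization of an equivariant linear map B -> hor_P
   intertwines the coactions because gamma does, and the Dirac operator is
   itself -i times the Cliffordization of nabla restricted to B. *)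
Require Import Defs.
From mathcomp Require Import all_boot all_algebra reals.
From mathcomp Require Import perm boolp classical_sets.
Import GRing.Theory Num.Theory.
Local Open Scope ring_scope.

Set Implicit Arguments.
Unset Strict Implicit.
Unset Printing Implicit Defensive.

(** * Linear maps, and retractions of injective ones *)

Section LinearProp.
Variable C : fieldType.
Implicit Types U V W : lmodType C.

Lemma linD U V (f : U -> V) : linear f -> {morph f : x y / x + y}.
Proof. by move=> Hf x y; rewrite -[x]scale1r Hf !scale1r. Qed.

Lemma lin0 U V (f : U -> V) : linear f -> f 0 = 0.
Proof.
by move=> Hf; have := linD Hf 0 0; rewrite addr0 -[LHS]addr0 => /addrI.
Qed.

Lemma linZ U V (f : U -> V) k x : linear f -> f (k *: x) = k *: f x.
Proof. by move=> Hf; rewrite -[k *: x]addr0 Hf (lin0 Hf) addr0. Qed.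

Lemma linN U V (f : U -> V) x : linear f -> f (- x) = - f x.
Proof. by move=> Hf; rewrite -scaleN1r linZ // scaleN1r. Qed.

Lemma lin_sum U V (f : U -> V) (I : Type) (r : seq I) (p : pred I)
    (E : I -> U) :
  linear f -> f (\sum_(i <- r | p i) E i) = \sum_(i <- r | p i) f (E i).
Proof. by move=> Hf; apply: (big_morph f (linD Hf) (lin0 Hf)). Qed.

Lemma linear_idfun U : linear (fun u : U => u).
Proof. by []. Qed.

Lemma linear_zero U V : linear (fun _ : U => 0 : V).
Proof. by move=> a x y; rewrite scaler0 addr0. Qed.

Lemma linear_comp U V W (f : V -> W) (g : U -> V) :
  linear f -> linear g -> linear (fun u => f (g u)).
Proof. by move=> Hf Hg a x y; rewrite Hg Hf. Qed.

Lemma linear_add U V (f g : U -> V) :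
  linear f -> linear g -> linear (fun u => f u + g u).
Proof. by move=> Hf Hg a x y; rewrite Hf Hg scalerDr addrACA. Qed.

Lemma linear_scale U V k (f : U -> V) : linear f -> linear (fun u => k *: f u).
Proof. by move=> Hf a x y; rewrite Hf scalerDr !scalerA mulrC. Qed.

Lemma linear_scalel U V (f : U -> C) (v : V) :
  linear (f : U -> C^o) -> linear (fun u => f u *: v).
Proof. by move=> Hf a x y; rewrite Hf scalerDl scalerA. Qed.

Lemma linear_sum_fun U V (I : Type) (r : seq I) (p : pred I) (f : I -> U -> V) :
  (forall i, linear (f i)) -> linear (fun u => \sum_(i <- r | p i) f i u).
Proof.
move=> Hf a x y; rewrite scaler_sumr -big_split; apply: eq_bigr => i _.
exact: Hf.
Qed.

Lemma linear_mull U (A : algType C) (f : U -> A) b :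
  linear f -> linear (fun u => f u * b).
Proof. by move=> Hf a x y; rewrite Hf mulrDl scalerAl. Qed.

Lemma linear_mulr U (A : algType C) (f : U -> A) b :
  linear f -> linear (fun u => b * f u).
Proof. by move=> Hf a x y; rewrite Hf mulrDr scalerAr. Qed.

(* Zorn's lemma is applied to the sets G of pairs whose union with the inverse
   graph of f is the graph of a partial linear map. *)
Lemma linear_retraction U W (f : U -> W) :
  linear f -> (forall u, f u = 0 -> u = 0) ->
  exists r : W -> U, linear r /\ forall u, r (f u) = u.
Proof.
move=> Hf injf.
pose gr : set (W * U) := [set p | p.1 = f p.2]%classic.
(* For a linear set of pairs, being single-valued amounts to the fibre over 0 being trivial. *)
pose Q (A : set (W * U)) := (forall k x y, A x -> A y -> A (k *: x + y)) /\
  (forall u, A (0, u) -> u = 0).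
have grlin k x y : gr x -> gr y -> gr (k *: x + y).
  by rewrite /gr /= => -> ->; rewrite Hf.
(* Taking the union with [gr] makes the empty chain harmless: its union is empty, and [gr] alone
   satisfies [Q] because [f] is linear and injective. *)
have [|G [[Glin Gfun] Gmax]] := @Zorn_bigcup _ (fun G => Q (G `|` gr)%classic).
  move=> X XQ Xtot; split.
  - move=> k x y [[A XA Ax]|grx] [[A' XA' A'y]|gry].
    + have [AA'|A'A] := Xtot _ _ XA XA'.
        have [lin _] := XQ _ XA'.
        have [H|H] := lin k x y (or_introl (AA' _ Ax)) (or_introl A'y).
          by left; exists A'.
        by right.
      have [lin _] := XQ _ XA.
      have [H|H] := lin k x y (or_introl Ax) (or_introl (A'A _ A'y)).
        by left; exists A.
      by right.
    + have [lin _] := XQ _ XA.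
      have [H|H] := lin k x y (or_introl Ax) (or_intror gry).
        by left; exists A.
      by right.
    + have [lin _] := XQ _ XA'.
      have [H|H] := lin k x y (or_intror grx) (or_introl A'y).
        by left; exists A'.
      by right.
    + by right; apply: grlin.
  - move=> u [[A XA Au]|gru]; last by apply: injf; rewrite -gru.
    by have [_] := XQ _ XA; apply; left.
pose A := (G `|` gr)%classic.
have A0 : A 0 by right; rewrite /gr /= (lin0 Hf).
have Atot w : exists u, A (w, u).
  apply: contrapT => /forallNP nA.
  (* If [w] were outside the domain, the line through [(w, 0)] could be added to [A], extending the
     map by the value 0 at [w]. This contradicts maximality. *)
  pose A' : set (W * U) :=
    [set p | exists a q, A q /\ p = q + (a *: w, 0)]%classic.
  have AA' p : A p -> A' p.
    move=> Ap; exists 0, p; split=> //.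
    by rewrite scale0r [(0, 0)](_ : _ = 0) ?addr0.
  have A'w : A' (w, 0).
    by exists 1, 0; split=> //; rewrite add0r scale1r.
  apply: (Gmax A').
    split; first by move=> p Gp; apply: AA'; left.
    by move=> /(_ _ A'w) Gw; apply: (nA 0); left.
  have -> : (A' `|` gr)%classic = A'.
    by apply/seteqP; split=> p; [case=> // Hp; apply: AA'; right | left].
  split.
    move=> k x y [a [q [Aq ->]]] [b [q' [Aq' ->]]].
    exists (k * a + b), (k *: q + q'); split; first exact: Glin.
    rewrite scalerDr addrACA; congr (_ + _); apply/eqP; rewrite xpair_eqE /=.
    by rewrite scaler0 addr0 scalerDl scalerA !eqxx.
  move=> u [a [[g v] [Agv [/eqP]]]]; rewrite addr0 => Hg ->.
  have [a0|a0] := eqVneq a 0.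
    apply: Gfun; move: Agv; rewrite -[g](_ : 0 = g) //.
    by apply/eqP; rewrite (eqP Hg) a0 scale0r addr0.
  (* Here [g + a *: w = 0] with [a] nonzero, so [w] is a multiple of [g] and already lies in the
     domain. *)
  exfalso; apply: (nA (- a^-1 *: v)).
  have -> : (w, - a^-1 *: v) = - a^-1 *: (g, v) + 0.
    rewrite addr0; congr (_, _); move: Hg; rewrite eq_sym addr_eq0 => /eqP ->.
    by rewrite scalerN scaleNr opprK scalerA mulVf ?scale1r.
  exact: Glin.
have [r Hr] := choice Atot.
have Auniq w u v : A (w, u) -> A (w, v) -> u = v.
  move=> Au Av; apply/eqP; rewrite -subr_eq0; apply/eqP; apply: Gfun.
  have -> : (0, u - v) = -1 *: (w, v) + (w, u).
    by congr (_, _) => /=; rewrite scaleN1r addrC ?subrr.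
  exact: Glin.
exists r; split=> [k x y|u].
  apply: Auniq (Hr _) _.
  have -> : (k *: x + y, k *: r x + r y) = k *: (x, r x) + (y, r y) by [].
  exact: (Glin _ _ _ (Hr x) (Hr y)).
by apply: Auniq (Hr _) _; right.
Qed.

End LinearProp.

(** * Universal vector spaces: spanning by generators and extensionality *)

Section FreeTheory.
Variables (C : fieldType) (X : choiceType).
Variable P : forall U : lmodType C, (X -> U) -> Prop.

Lemma fsum_lin (U V : lmodType C) (F : U -> V) (f : X -> U) s :
  linear F -> F (fsum f s) = fsum (fun x => F (f x)) s.
Proof.
by move=> HF; rewrite /fsum lin_sum //; apply: eq_bigr => p _; rewrite linZ.
Qed.

(** The lifts of maps satisfying [P] separate points and agree on both sides. Spanning by generators
    is the source of every later reduction to pure tensors or words. *)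
Lemma free_sum (z : Defs.free P) : z = fsum (gen P) (repr z).
Proof.
apply/free_eqP => U f Pf; rewrite (fsum_lin _ _ (flift_linear Pf)).
by rewrite {1}/flift /fsum; apply: eq_bigr => p _; rewrite flift_gen.
Qed.

Lemma free_ext (U : lmodType C) (F H : Defs.free P -> U) :
  linear F -> linear H ->
  (forall x, F (gen P x) = H (gen P x)) -> F =1 H.
Proof.
move=> HF HH FH z; rewrite [z]free_sum !fsum_lin //.
by apply: eq_bigr => p _; rewrite FH.
Qed.

(* [flift f z] is a fixed linear combination of values of f, so [P f] is not
   needed here, nor in [flift_lin]. *)
Lemma linear_flift_param (U V : lmodType C) (f : V -> X -> U)
    (z : Defs.free P) :
  (forall x, linear (fun u => f u x)) -> linear (fun u => flift (f u) z).
Proof.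
move=> Hf; apply: linear_sum_fun => p; exact: linear_scale.
Qed.

Lemma flift_lin (U V : lmodType C) (F : U -> V) (f : X -> U) (z : Defs.free P) :
  linear F -> F (flift f z) = flift (fun x => F (f x)) z.
Proof. exact: fsum_lin. Qed.

Lemma flift0_fun (U : lmodType C) (z : Defs.free P) :
  flift (fun _ => 0 : U) z = 0.
Proof. by rewrite /flift /fsum big1 // => p _; rewrite scaler0. Qed.

End FreeTheory.

(** * Tensor products of vector spaces *)

Section TensorTheory.
Variable C : numClosedFieldType.
Implicit Types U V W L : lmodType C.

Lemma bilinear_l U V W L (f : U -> V -> W) (g : L -> U) v :
  bilinear_map f -> linear g -> linear (fun u => f (g u) v).
Proof. by move=> [Hf _] Hg; apply: (linear_comp (Hf v) Hg). Qed.

Lemma bilinear_r U V W L (f : U -> V -> W) (g : L -> V) u :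
  bilinear_map f -> linear g -> linear (fun v => f u (g v)).
Proof. by move=> [_ Hf] Hg; apply: (linear_comp (Hf u) Hg). Qed.

Lemma tpure_bilinear U V : bilinear_map (@tpure C U V).
Proof.
split=> [w|v] a x y; apply/free_eqP => L f Pf;
  rewrite (flift_linear Pf) !flift_gen //; have [Pl Pr] := Pf; first exact: Pl.
exact: Pr.
Qed.

Lemma linear_tpurel U V L (f : L -> U) (v : V) :
  linear f -> linear (fun u => f u \ot v).
Proof. exact/bilinear_l/tpure_bilinear. Qed.

Lemma linear_tpurer U V L (f : L -> V) (u : U) :
  linear f -> linear (fun x => u \ot f x).
Proof. exact/bilinear_r/tpure_bilinear. Qed.

Lemma tlift_linear U V W (f : U -> V -> W) : bilinear_map f -> linear (tlift f).
Proof. by move=> Hf; apply: flift_linear. Qed.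

Lemma linear_tlift U V W L (f : U -> V -> W) (g : L -> tens U V) :
  bilinear_map f -> linear g -> linear (fun u => tlift f (g u)).
Proof. by move=> Hf; apply: linear_comp; apply: tlift_linear. Qed.

Lemma linear_tlift_param U V W L (f : L -> U -> V -> W) (z : tens U V) :
  (forall x y, linear (fun u => f u x y)) -> linear (fun u => tlift (f u) z).
Proof. by move=> Hf; apply: linear_flift_param => p. Qed.

Lemma tliftE U V W (f : U -> V -> W) u v :
  bilinear_map f -> tlift f (u \ot v) = f u v.
Proof. by move=> Hf; rewrite /tlift flift_gen. Qed.

Lemma tlift_lin U V W L (F : W -> L) (f : U -> V -> W) (z : tens U V) :
  linear F -> F (tlift f z) = tlift (fun x y => F (f x y)) z.
Proof. exact: flift_lin. Qed.

Lemma tens_ext U V W (F H : tens U V -> W) : linear F -> linear H ->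
  (forall u v, F (u \ot v) = H (u \ot v)) -> F =1 H.
Proof. by move=> HF HH FH; apply: free_ext => // -[]. Qed.

Lemma linear_tmap U V U' V' (f : U -> U') (g : V -> V') :
  linear f -> linear g -> linear (tmap f g).
Proof.
move=> Hf Hg; apply: tlift_linear; split=> ?.
  exact: linear_tpurel.
exact: linear_tpurer.
Qed.

Lemma tmapE U V U' V' (f : U -> U') (g : V -> V') u v :
  linear f -> linear g -> tmap f g (u \ot v) = f u \ot g v.
Proof.
move=> Hf Hg; apply: tliftE; split=> ?.
  exact: linear_tpurel.
exact: linear_tpurer.
Qed.

End TensorTheory.


(* Proves [linear f] and [bilinear_map f] by recursion on the body of f, using
   the (bi)linearity hypotheses of the context.  The case analysis is syntactic
   because [apply:] alone would unfold [tlift] to a sum. *)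
Ltac lin1 :=
  cbv beta;
  lazymatch goal with
  | |- forall _, _ => intro
  | |- bilinear_map _ => split=> ?
  | |- GRing.linear_for _ ?f =>
    match f with
    | (fun u => u) => exact: linear_idfun
    | (fun u => @tpure _ _ _ (@?g u) ?v) => apply: (linear_tpurel (f := g) v)
    | (fun u => @tpure _ _ _ ?v (@?g u)) => apply: (linear_tpurer (f := g) v)
    | (fun u => @tlift _ _ _ _ (@?F u) ?z) =>
        apply: (linear_tlift_param (f := F)) => ? ?
    | (fun u => @tlift _ _ _ _ ?F (@?g u)) =>
        apply: (linear_tlift (f := F) (g := g))
    | (fun u => @GRing.scale _ _ ?k (@?g u)) => apply: linear_scale
    | (fun u => @GRing.add _ (@?g u) (@?h u)) => apply: linear_add
    | (fun u => @GRing.mul _ (@?g u) ?v) => apply: linear_mull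
    | (fun u => @GRing.mul _ ?v (@?g u)) => apply: linear_mulr
    | (fun u => @bigop.body _ _ _ _ _) => apply: linear_sum_fun => ?
    | (fun u => ?h (@?g u) ?v) =>
        match goal with
        | H : bilinear_map ?h' |- _ =>
            unify h h'; apply: (bilinear_l (f := h) (g := g) v H)
        end
    | (fun u => ?h ?v (@?g u)) =>
        match goal with
        | H : bilinear_map ?h' |- _ =>
            unify h h'; apply: (bilinear_r (f := h) (g := g) v H)
        end
    | (fun u => ?h (@?g u)) =>
        match goal with
        | H : GRing.linear_for _ ?h' |- _ => unify h h';
            apply: (linear_comp (f := h) (g := g) H)
        end
    | @GRing.mul _ ?v => exact: (linear_mulr v (@linear_idfun _ _))
    | _ => assumption
    | _ => match goal with
        | H : bilinear_map _ |- _ =>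
            first [exact: (proj1 H _) | exact: (proj2 H _)]
        end
    end
  end.
Ltac lin := repeat lin1.

(** * Products of tensors with one leg in an algebra *)

Section TensorProduct.
Variables (C : numClosedFieldType) (A : algType C).
Implicit Types M N L : lmodType C.

Lemma tprod_bilinear M N L (f : M -> N -> L) :
  bilinear_map f -> bilinear_map (@tprod C A M N L f).
Proof. by move=> Hf; rewrite /tprod; lin. Qed.

Lemma tprodE M N L (f : M -> N -> L) m a n b :
  bilinear_map f -> @tprod C A M N L f (m \ot a) (n \ot b) = f m n \ot (a * b).
Proof. by move=> Hf; rewrite /tprod !tliftE //; lin. Qed.

End TensorProduct.

(** * The tensor algebra and concatenation *)

Section TensorAlgebraTheory.
Variables (C : numClosedFieldType) (V : lmodType C).
Implicit Types (U L : lmodType C) (w l r : seq V).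

Lemma tword_letterwise : letterwise_linear (@tword C V).
Proof.
move=> l r a x y; apply/free_eqP => L f Pf.
by rewrite (flift_linear Pf) !flift_gen // Pf.
Qed.

Lemma linear_tword L l r (f : L -> V) :
  linear f -> linear (fun u => tword (l ++ f u :: r)).
Proof. by move=> Hf; apply: (linear_comp (tword_letterwise l r) Hf). Qed.

Lemma talg_ext U (F H : talg V -> U) : linear F -> linear H ->
  (forall w, F (tword w) = H (tword w)) -> F =1 H.
Proof. exact: free_ext. Qed.

Lemma tcat_bilinear : bilinear_map (@tcat C V).
Proof.
split=> [t|s].
  apply: flift_linear => l r; apply: linear_flift_param => v a x y.
  by rewrite -!catA !cat_cons tword_letterwise.
apply: linear_flift_param => u; apply: flift_linear => l r a x y.
by rewrite !catA tword_letterwise.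
Qed.

Lemma tcatE w w' : tcat (tword w) (tword w') = tword (w ++ w').
Proof.
rewrite /tcat flift_gen; last first.
  move=> l r; apply: linear_flift_param => v a x y.
  by rewrite -!catA !cat_cons tword_letterwise.
rewrite flift_gen // => l r a x y.
by rewrite !catA tword_letterwise.
Qed.

Lemma tcatt0 (t : talg V) : tcat t (tword [::]) = t.
Proof.
have [H _] := tcat_bilinear.
move: t; apply: (@talg_ext _ (fun z => tcat z (tword [::])) id) => // w.
by rewrite tcatE cats0.
Qed.

Lemma tcat0t (t : talg V) : tcat (tword [::]) t = t.
Proof.
have [_ H] := tcat_bilinear.
move: t; apply: (@talg_ext _ (fun z => tcat (tword [::]) z) id) => // w.
by rewrite tcatE.
Qed.

End TensorAlgebraTheory.

(** * Linearity of the braided antisymmetrizer, and its values in degrees 0 and 1 *)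

Section AntisymmetrizerTheory.
Variables (C : numClosedFieldType) (V : lmodType C).
Variable sigma : tens V V -> tens V V.
Implicit Types U L : lmodType C.
Hypothesis sigma_lin : linear sigma.

(** The map [T] is general, rather than [tword], so that the induction on [i] can absorb the first
    letter of the word into it. *)
Lemma op_at_letterwise U i (T : seq V -> U) : letterwise_linear T ->
  letterwise_linear (fun w => match drop i w with
    | x :: y :: r =>
        sw (x', y') := sigma (x \ot y) in T (take i w ++ x' :: y' :: r)
    | _ => T w
    end).
Proof.
elim: i T => [|i IH] T HT l r; last first.
  case: l => [|a l] /=; last first.
    by apply: (IH (fun w => T (a :: w))) => l' r'; apply: (HT (a :: l')).
  case: (drop i r) => [|u [|v q]]; [exact: (HT [::])|exact: (HT [::])|].
  by apply: linear_tlift_param => x' y'; apply: (HT [::]).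
have HT2 q : bilinear_map (fun x y : V => T (x :: y :: q)).
  by split=> z; [apply: (HT [::]) | apply: (HT [:: z])].
case: l => [|a [|b l]] /=; rewrite ?drop0 ?take0.
- case: r => [|z r]; first exact: (HT [::]).
  by apply: linear_tlift (HT2 r) _; lin.
- by apply: linear_tlift (HT2 r) _; lin.
- by apply: linear_tlift_param => x' y'; apply: (HT [:: x', y' & l]).
Qed.

Lemma op_at_linear i : linear (@op_at C V sigma i).
Proof. exact/flift_linear/op_at_letterwise/tword_letterwise. Qed.

Lemma sigma_perm_linear n (p : 'S_n) : linear (@sigma_perm C V sigma n p).
Proof.
rewrite /sigma_perm; elim: (reduced_word p) => //= i s IH.
exact: linear_comp (op_at_linear i) IH.
Qed.

Let antisym_word_letterwise : letterwise_linear (fun w =>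
  \sum_(p : 'S_(size w)) (-1) ^+ inversions p *: sigma_perm sigma p (tword w)).
Proof.
(* The index type depends on the length of the word. Fixing [n] separates linearity from the length,
   which does not change when a letter is replaced. *)
pose f n t := \sum_(p : 'S_n) (-1) ^+ inversions p *: sigma_perm sigma p t.
have f_lin n : linear (f n).
  by apply: linear_sum_fun => p; apply: linear_scale; apply: sigma_perm_linear.
suff H l r : linear (fun x => f (size (l ++ x :: r)) (tword (l ++ x :: r))).
  exact: H.
by move=> a x y; rewrite !size_cat /= tword_letterwise f_lin.
Qed.

Lemma antisym_linear : linear (antisym sigma).
Proof. exact: flift_linear. Qed.

Lemma reduced_word_le1 n (p : 'S_n) : (n <= 1)%N ->
  inversions p = 0%N /\ reduced_word p = [::].
Proof.
move=> n1; have inv0 : inversions p = 0%N.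
  apply/eqP; rewrite cards_eq0; apply/eqP/setP => -[i j]; rewrite !inE /=.
  by case: n n1 p i j => [|[|//]] _ p i j; [case: i | rewrite !ord1].
(* Both branches give the empty word: a tuple that is found has length [inversions p], which is 0,
   and the default is empty. *)
split=> //; rewrite /reduced_word; case: pickP => // w _.
by apply: size0nil; rewrite size_tuple.
Qed.

(** There is a single permutation, and its reduced word is empty. This is what evaluates the
    coproduct and the pairing on letters. *)
Lemma antisym_tword_le1 (w : seq V) :
  (size w <= 1)%N -> antisym sigma (tword w) = tword w.
Proof.
move=> w1; rewrite /antisym flift_gen //.
rewrite (eq_bigr (fun=> tword w)) => [|p _].
  rewrite sumr_const card_Sn.
  by case: w w1 => [|x [|]].
by have [-> rw] := reduced_word_le1 p w1; rewrite /sigma_perm rw /= scale1r.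
Qed.

End AntisymmetrizerTheory.

(** * The exterior algebra as a quotient, and its coproduct *)

Section ExteriorTheory.
Variables (C : numClosedFieldType) (V : lmodType C).
Variable sigma : tens V V -> tens V V.
Implicit Types (U L : lmodType C).

Lemma wcls_linear : linear (wcls sigma).
Proof.
move=> a x y; apply/free_eqP => L f Pf; have [f_lin _] := Pf.
by rewrite (flift_linear Pf) !flift_gen // f_lin.
Qed.

Lemma wcls0 t : antisym sigma t = 0 -> wcls sigma t = 0.
Proof.
move=> t0; apply/free_eqP => L f Pf; have [_ fK] := Pf.
by rewrite flift_gen // (lin0 (flift_linear Pf)) fK.
Qed.

(** An element of [ext] is a formal combination of tensors; linearity of [wcls] collapses it to the
    class of the actual combination. *)
Lemma wclsP (p : ext sigma) : exists t, p = wcls sigma t.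
Proof.
exists (\sum_(q <- repr p) q.1 *: q.2); rewrite (lin_sum _ _ _ wcls_linear).
rewrite [LHS]free_sum; apply: eq_bigr => q _.
by rewrite linZ //; apply: wcls_linear.
Qed.

Lemma linear_wcls L (f : L -> talg V) :
  linear f -> linear (fun u => wcls sigma (f u)).
Proof. exact/linear_comp/wcls_linear. Qed.

Hypothesis sigma_lin : linear sigma.

(** Since [wret] is chosen by [xget], its properties follow once some retraction exists. One does,
    because the quotient by the kernel of [antisym] makes [wanti] injective. *)
Lemma wret_wanti : linear (wret sigma) /\
  forall p : ext sigma, wret sigma (wanti p) = p.
Proof.
have wP : linear (antisym sigma) /\
    forall t, antisym sigma t = 0 -> antisym sigma t = 0.
  by split=> //; apply: antisym_linear.
pose retr : set (talg V -> ext sigma) :=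
  [set r | linear r /\ forall p : ext sigma, r (wanti p) = p]%classic.
have [r Hr] : exists r, retr r.
  apply: linear_retraction => [|p]; first exact: flift_linear.
  have [t ->] := wclsP p; rewrite /wanti flift_gen //; exact: wcls0.
exact: (xgetI (P := retr) _ Hr).
Qed.

Lemma wanti_linear : linear (@wanti C V sigma).
Proof. by apply: flift_linear; split=> //; apply: antisym_linear. Qed.

Lemma wanti_wcls t : wanti (wcls sigma t) = antisym sigma t.
Proof. by rewrite /wanti flift_gen //; split=> //; apply: antisym_linear. Qed.

Lemma deconcat_letterwise : letterwise_linear (fun w : seq V =>
  \sum_(k < (size w).+1) tword (take k w) \ot tword (drop k w)).
Proof.
move=> l r; pose T2 := tens (talg V) (talg V).
(* Indexing the cuts by natural numbers frees the index type from the word. *)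
pose f (w : seq V) :=
  \sum_(0 <= k < (size w).+1) tword (take k w) \ot tword (drop k w).
suff: linear (fun x => f (l ++ x :: r)).
  by move=> H a x y; have := H a x y; rewrite /f !big_mkord.
move=> a x y; rewrite /f !size_cat /= scaler_sumr -big_split.
(* The varying letter lies inside the right factor, heads the right factor, or lies in the left
   factor, according as [k] is less than, equal to or greater than [size l]. *)
apply: eq_bigr => k _ /=; rewrite !take_cat !drop_cat; case: ltnP => kl.
  have H : linear (fun u =>
      tword (take k l) \ot tword (drop k l ++ u :: r) : T2).
    by lin; apply: tword_letterwise.
  exact: H.
case: (k - size l)%N => [|m] /=; rewrite ?take0 ?drop0.
  have H : linear (fun u => tword (l ++ [::]) \ot tword (u :: r) : T2).
    by lin; apply: (tword_letterwise [::]).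
  exact: H.
have H : linear (fun u => tword (l ++ u :: take m r) \ot tword (drop m r) : T2).
  by lin; apply: tword_letterwise.
exact: H.
Qed.

Lemma deconcat_linear : linear (@deconcat C V).
Proof. exact/flift_linear/deconcat_letterwise. Qed.

Lemma wcoprod_linear : linear (@wcoprod C V sigma).
Proof.
have [r_lin _] := wret_wanti.
apply: linear_comp (linear_tmap r_lin r_lin) _.
exact: linear_comp deconcat_linear wanti_linear.
Qed.

End ExteriorTheory.

(** * The exterior product on classes *)

Section ExteriorProduct.
Variables (C : numClosedFieldType) (V : lmodType C).
Variable sigma : tens V V -> tens V V.
Hypothesis antisym_ideal : forall l t r : talg V,
  antisym sigma t = 0 -> antisym sigma (tcat l (tcat t r)) = 0.

Let wmulr_lift s : linear (fun t => wcls sigma (tcat s t)) /\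
  forall t, antisym sigma t = 0 -> wcls sigma (tcat s t) = 0.
Proof.
have [_ H] := tcat_bilinear V; split=> [|t t0].
  exact: linear_wcls.
by apply: wcls0; rewrite -[t]tcatt0; apply: antisym_ideal.
Qed.

Let wmull_lift (q : ext sigma) :
  linear (fun s => flift (fun t => wcls sigma (tcat s t)) q) /\
  forall s, antisym sigma s = 0 -> flift (fun t => wcls sigma (tcat s t)) q = 0.
Proof.
have [H _] := tcat_bilinear V; split=> [|t t0].
  by apply: linear_flift_param => t; apply: linear_wcls.
(* As [flift] at [q] is a fixed combination of values, it is enough that the lifted function
   vanishes identically. *)
rewrite -[RHS](flift0_fun _ q); congr (flift _ q); apply/funext => s.
by apply: wcls0; rewrite -[tcat t s]tcat0t; apply: antisym_ideal.
Qed.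

Lemma wmul_bilinear : bilinear_map (@wmul C V sigma).
Proof.
split=> [q|p]; first exact: flift_linear.
by apply: linear_flift_param => s; apply: flift_linear.
Qed.

Lemma wmulE s t : wmul (wcls sigma s) (wcls sigma t) = wcls sigma (tcat s t).
Proof. by rewrite /wmul flift_gen // flift_gen. Qed.

End ExteriorProduct.

(** * Module structure and coaction on the tensor algebra *)

Section CoordSpaceTheory.
Variables (C : numClosedFieldType) (G : cmqg C) (V : coordSpace G).

Lemma linear_counit (U L : lmodType C) (f : L -> G) (u : U) :
  linear f -> linear (fun a => counit (f a) *: u).
Proof. by move=> Hf a x y; rewrite Hf counit_linear scalerDl scalerA. Qed.

Lemma coprod_linear : linear (@coprod C G).
Proof. by case: (coprod_hom G). Qed.

Lemma coprod1 : @coprod C G 1 = 1 \ot 1.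
Proof. by case: (coprod_hom G). Qed.

Lemma circ_word_letterwise a :
  letterwise_linear (fun w : seq V => circ_word w a).
Proof.
have [H _] := tcat_bilinear V; have [vl _ _] := vcirc_module V.
have [_ Hr] := tcat_bilinear V.
(* The element [a] stays general, because the rest of the word is acted on by the second leg of its
   coproduct. *)
move=> l; elim: l a => [|z l IH] a r /=; apply: linear_tlift_param => b c.
  apply: (linear_comp (H _)); apply: (linear_tword [::] [::]).
  exact: bilinear_l vl _.
by apply: (linear_comp (Hr _)); apply: IH.
Qed.

Lemma circ_word_linear (w : seq V) : linear (circ_word w).
Proof.
have [H Hr] := tcat_bilinear V; have [vl _ _] := vcirc_module V.
elim: w => [|x w IH] /=; first exact: linear_counit.
apply: linear_comp coprod_linear; apply: tlift_linear; split=> [b|a].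
  apply: (linear_comp (H _)); apply: (linear_tword [::] [::]).
  exact: bilinear_r vl _.
exact: (linear_comp (Hr _)).
Qed.

Lemma tcirc_bilinear : bilinear_map (@tcirc C G V).
Proof.
split=> [a|t]; first exact/flift_linear/circ_word_letterwise.
by apply: linear_flift_param => w; apply: circ_word_linear.
Qed.

Lemma tcirc1 (t : talg V) : tcirc t 1 = t.
Proof.
have [Hl _] := tcirc_bilinear; have [H _] := tcat_bilinear V.
have [Hv v1 _] := vcirc_module V.
move: t; apply: (@talg_ext _ _ _ (fun t => tcirc t 1) id) => // w.
rewrite /tcirc flift_gen; last exact: circ_word_letterwise.
elim: w => [|x w IH] /=; first by rewrite counit1 scale1r.
rewrite coprod1 tliftE ?IH ?v1 ?tcatE //; split=> [b|a].
  apply: (linear_comp (H _)); apply: (linear_tword [::] [::]).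
  exact: bilinear_r Hv _.
apply: linear_comp (circ_word_linear w); by have [_] := tcat_bilinear V.
Qed.

Lemma kap_word_letterwise : letterwise_linear (@kap_word C G V).
Proof.
have tb := tcat_bilinear V; have [kl _ _] := vkap_coaction V.
have Hb : bilinear_map (fun (y : V) u => tcat (tword [:: y]) u).
  have [t1 t2] := tb; split=> // u; apply: (linear_comp (t1 _)).
  exact: (linear_tword [::] [::]).
have [pl pr] := tprod_bilinear G Hb.
elim=> [|z l IH] r /=; first exact: (linear_comp (pl _)).
exact: linear_comp (pr _) (IH r).
Qed.

Lemma tkap_linear : linear (@tkap C G V).
Proof. exact/flift_linear/kap_word_letterwise. Qed.

End CoordSpaceTheory.

(** * Structures induced on the exterior algebra, and the twisting by scalars *)

Section MetricTheory.
Variables (C : numClosedFieldType) (G : cmqg C) (V : coordSpace G).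
Variable M : qmetric V.
Notation W := (ext (sigma M)).
Notation cls := (wcls (sigma M)).

(** By [antisym_ker] the kernel is the ideal generated by the image of 1 + [tau], and ideals are
    stable under two-sided multiplication. *)
Lemma antisym_ideal (l t r : talg V) :
  antisym (sigma M) t = 0 -> antisym (sigma M) (tcat l (tcat t r)) = 0.
Proof. by move=> /(antisym_ker M) H; apply/(antisym_ker M)/tideal_mul. Qed.

Let wmul_bil := wmul_bilinear antisym_ideal.

Let wcirc_lift a : linear (fun t => cls (tcirc t a)) /\
  forall t, antisym (sigma M) t = 0 -> cls (tcirc t a) = 0.
Proof.
have [Hl _] := tcirc_bilinear V; split; first exact: linear_wcls.
by move=> t t0; apply/wcls0/ext_circ.
Qed.

Lemma wcirc_bilinear : bilinear_map (@wcirc C G V (sigma M)).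
Proof.
split=> [a|p]; first exact: flift_linear.
apply: linear_flift_param => t; apply: linear_wcls.
by have [] := tcirc_bilinear V.
Qed.

Lemma wcirc1 (p : W) : wcirc p 1 = p.
Proof.
by have [t ->] := wclsP p; rewrite /wcirc flift_gen // tcirc1.
Qed.

Let wkap_lift : linear (fun t => tmap cls id (tkap t)) /\
  forall t, antisym (sigma M) t = 0 -> tmap cls id (tkap t) = 0.
Proof.
split; last by move=> t; apply: ext_kap.
apply: linear_comp (@tkap_linear _ _ V); apply: linear_tmap => //.
exact: wcls_linear.
Qed.

Lemma wkap_linear : linear (@wkap C G V (sigma M)).
Proof. exact: flift_linear. Qed.

Lemma wkap_nil : wkap (cls (tword [::])) = cls (tword [::]) \ot 1.
Proof.
rewrite /wkap flift_gen // /tkap flift_gen; last exact: kap_word_letterwise.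
by rewrite tmapE //; apply: wcls_linear.
Qed.

Section Twisting.

Lemma twist_bilinear : bilinear_map (@twist C G V (Sig M) (twh M)).
Proof.
split=> [s|x].
  by apply: linear_sum_fun => i; apply: linear_scalel => a x y; rewrite linearP.
apply: linear_sum_fun => i; apply: linear_scale; apply: linear_sum_fun => j.
by apply: linear_tpurel; apply: twh_linear.
Qed.

Lemma twist1 (x : V) : twist (twh M) x 1 = 1 \ot x.
Proof.
rewrite /twist twh1; have [_ Hr] := tpure_bilinear (Sig M) V.
rewrite [in RHS](coord_basis (cbasisP V) (memvf x)) (lin_sum _ _ _ (Hr _)).
apply: eq_bigr => i _; rewrite (linZ _ _ (Hr _)); congr (_ *: _).
(* [twh 1] is the identity matrix, so only the diagonal term of the inner sum survives. *)
rewrite (bigD1 i) //= big1 => [|j ji].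
  by rewrite mxE eqxx addr0 /theta (tnth_nth 0).
have [Hl _] := tpure_bilinear (Sig M) V.
by rewrite mxE eq_sym (negPf ji) (lin0 (Hl _)).
Qed.

Let cons_bilinear : bilinear_map (fun (y : V) u => tcat (tword [:: y]) u).
Proof.
have [t1 t2] := tcat_bilinear V; split=> // u; apply: (linear_comp (t1 _)).
exact: (linear_tword [::] [::]).
Qed.

Let twist_step_bilinear x : bilinear_map (fun s' (u : talg V) =>
  sw (s'', y) := twist (twh M) x s' in s'' \ot tcat (tword [:: y]) u).
Proof.
have cb := cons_bilinear; have tb := twist_bilinear.
split=> z; last first.
  by apply: linear_tlift_param => ? ?; lin; apply: bilinear_r cb _.
by lin; apply: bilinear_l cb _.
Qed.

Lemma twist_word_letterwise s :
  letterwise_linear (fun w : seq V => twist_word (twh M) w s).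
Proof.
have tb := twist_bilinear; have cb := cons_bilinear; elim=> [|z l IH] r /=.
  by apply: linear_tlift_param => s' u; lin; apply: bilinear_l cb _.
exact: linear_comp (tlift_linear (twist_step_bilinear z)) (IH r).
Qed.

Lemma twist_word_linear (w : seq V) : linear (twist_word (twh M) w).
Proof.
elim: w => [|x w IH] /=; first by lin.
exact: linear_comp (tlift_linear (twist_step_bilinear x)) IH.
Qed.

Lemma ttwist_bilinear : bilinear_map (@ttwist C G V (Sig M) (twh M)).
Proof.
split=> [s|t]; first exact/flift_linear/twist_word_letterwise.
by apply: linear_flift_param => w; apply: twist_word_linear.
Qed.

Lemma twist_word1 x : twist_word (twh M) [:: x] 1 = 1 \ot tword [:: x].
Proof.
have cb := cons_bilinear.
rewrite /= tliftE; last exact: twist_step_bilinear.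
by rewrite twist1 tliftE ?tcatE //; lin.
Qed.

End Twisting.
End MetricTheory.

(** * The extended metric and the Clifford product of two vectors *)

Section Pairing.
Variables (C : numClosedFieldType) (G : cmqg C) (V : coordSpace G).
Variable M : qmetric V.
Notation W := (ext (sigma M)).
Notation cls := (wcls (sigma M)).
Notation Sg := (Sig M).
Notation gw := (g_word (twh M) (met M)).
Notation gpair := (tg (twh M) (met M)).
Notation gwpair := (wg (twh M) (met M)).

Let met_bilinear : bilinear_map (fun x y : V => met M (x \ot y)).
Proof. by have H := met_linear M; lin. Qed.

Let g_cons_letterwise (v : seq V) (y : V) : linear (gw v) ->
  letterwise_linear (fun u : seq V => match rev u with
    | [::] => 0 : Sg
    | x :: ru => sw (s, u') := twist_word (twh M) (rev ru) (met M (x \ot y)) in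
                 s * gw v u'
    end).
Proof.
move=> IH l r; have mb := met_bilinear.
have Hb : bilinear_map (fun (s : Sg) u' => s * gw v u') by lin.
(* The pairing consumes the last letter of the left word. After reversal, the varying letter is that
   last one when [r] is empty, and linearity comes from the metric; otherwise it is in the
   remainder, and linearity comes from [twist_word]. *)
suff H : linear (fun x => match rev r ++ x :: rev l with
    | [::] => 0 : Sg
    | x :: ru => sw (s, u') := twist_word (twh M) (rev ru) (met M (x \ot y)) in
                 s * gw v u'
    end).
  by move=> a x z; have := H a x z; rewrite !rev_cat !rev_cons -!cats1 -!catA.
case: (rev r) => [|z rr] /=.
  have ml := met_linear M; have tl := @twist_word_linear _ _ _ M (rev (rev l)).
  by lin.
apply: (linear_comp (tlift_linear Hb)) => a x1 x2.
by rewrite !rev_cat !rev_cons -!cats1 -!catA twist_word_letterwise.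
Qed.

Let g_nil_letterwise :
  letterwise_linear (fun u : seq V => if u is [::] then 1 else 0 : Sg).
Proof. by case=> [|z l] r a x y /=; rewrite scaler0 addr0. Qed.

Lemma g_word_linear v : linear (gw v).
Proof.
elim: v => [|y v IH] /=; apply: flift_linear.
  exact: g_nil_letterwise.
exact: g_cons_letterwise.
Qed.

Lemma g_word_letterwise t : letterwise_linear (fun v => gw v t).
Proof.
have mb := met_bilinear.
move=> l; elim: l t => [|z l IH] t r /=; apply: linear_flift_param => u.
  case: (rev u) => [|z ru]; first exact: linear_zero.
  have Hb : bilinear_map (fun (s : Sg) u' => s * gw r u').
    by have := g_word_linear r; lin.
  have gl := @g_word_linear r; have ml := met_linear M.
  by have tl := @twist_word_linear _ _ _ M (rev ru); lin.
case: (rev u) => [|x ru]; first exact: linear_zero.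
by apply: linear_tlift_param => s u'; apply: linear_mulr; apply: IH.
Qed.

Lemma tg_bilinear : bilinear_map gpair.
Proof.
split=> [t'|t]; last exact/flift_linear/g_word_letterwise.
by apply: linear_flift_param => v; apply: g_word_linear.
Qed.

Lemma tg_tword (v : seq V) t : gpair t (tword v) = gw v t.
Proof. by rewrite /tg flift_gen //; apply: g_word_letterwise. Qed.

Let g_word_nil u : gw [::] (tword u) = if u is [::] then 1 else 0.
Proof. by rewrite /= flift_gen //; apply: g_nil_letterwise. Qed.

Let g_word_cons y v u : gw (y :: v) (tword u) = match rev u with
    | [::] => 0 : Sg
    | x :: ru => sw (s, u') := twist_word (twh M) (rev ru) (met M (x \ot y)) in
                 s * gw v u'
    end.
Proof. exact: (flift_gen _ (g_cons_letterwise y (g_word_linear v))). Qed.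

Lemma tg_nil_nil : gpair (tword [::]) (tword [::]) = 1.
Proof. by rewrite tg_tword g_word_nil. Qed.

Lemma tg_nil_letter x : gpair (tword [::]) (tword [:: x]) = 0.
Proof. by rewrite tg_tword g_word_cons. Qed.

Lemma tg_letter_nil x : gpair (tword [:: x]) (tword [::]) = 0.
Proof. by rewrite tg_tword g_word_nil. Qed.

Lemma tg_letter_letter x y :
  gpair (tword [:: x]) (tword [:: y]) = met M (x \ot y).
Proof.
have gl := @g_word_linear [::].
rewrite tg_tword g_word_cons.
rewrite -[LHS]/(sw (s, u') := met M (x \ot y) \ot tword [::] in
  s * gw [::] u').
by rewrite tliftE ?g_word_nil ?mulr1 //; lin.
Qed.

Let antiM := antisym_linear (sigma_linear M).

Let wg_inner t :
  linear (fun t' => gpair t (antisym (sigma M) t')) /\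
  forall t', antisym (sigma M) t' = 0 -> gpair t (antisym (sigma M) t') = 0.
Proof.
have [_ Hr] := tg_bilinear; split; first exact: linear_comp (Hr t) antiM.
by move=> t' ->; apply: lin0.
Qed.

Let wg_outer (q : W) :
  linear (fun t => flift (fun t' => gpair t (antisym (sigma M) t')) q) /\
  forall t, antisym (sigma M) t = 0 ->
    flift (fun t' => gpair t (antisym (sigma M) t')) q = 0.
Proof.
have [Hl _] := tg_bilinear; split=> [|t t0]; first exact: linear_flift_param.
rewrite -[RHS](flift0_fun _ q); congr (flift _ q); apply/funext => s.
exact: ext_met.
Qed.

Lemma wg_bilinear : bilinear_map (@wg _ _ _ _ (twh M) (met M) (sigma M)).
Proof.
split=> [q|p]; first exact: flift_linear.
by apply: linear_flift_param => t; apply: flift_linear.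
Qed.

Lemma wgE t t' : gwpair (cls t) (cls t') =
  gpair t (antisym (sigma M) t').
Proof. by rewrite /wg flift_gen // flift_gen. Qed.

Let wtwist_lift s : linear (fun t => tmap id cls (ttwist (twh M) t s)) /\
  forall t, antisym (sigma M) t = 0 -> tmap id cls (ttwist (twh M) t s) = 0.
Proof.
split; last by move=> t; apply: ext_twist.
have [Hl _] := ttwist_bilinear M.
by apply: (linear_comp (linear_tmap _ (@wcls_linear _ _ _))) (Hl s).
Qed.

Lemma wtwist_bilinear : bilinear_map (wtwist (twh M) (sigma := sigma M)).
Proof.
split=> [q|p]; first exact: flift_linear.
apply: linear_flift_param => t; have [_ Hr] := ttwist_bilinear M.
by apply: (linear_comp (linear_tmap _ (@wcls_linear _ _ _))) (Hr t).
Qed.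

Lemma wtwist_nil s :
  wtwist (twh M) (cls (tword [::])) s = s \ot cls (tword [::]).
Proof.
rewrite /wtwist flift_gen // /ttwist flift_gen; last first.
  exact: twist_word_letterwise.
by rewrite tmapE //; apply: wcls_linear.
Qed.

Lemma wtwist1_letter x :
  wtwist (twh M) (cls (tword [:: x])) 1 = 1 \ot cls (tword [:: x]).
Proof.
rewrite /wtwist flift_gen // /ttwist flift_gen; last first.
  exact: twist_word_letterwise.
by rewrite twist_word1 tmapE //; apply: wcls_linear.
Qed.

(** In degrees 0 and 1 the antisymmetrizer is the identity, so [wret] agrees there with [wcls]
    whatever retraction was chosen, and the two cuts of a one-letter word can be evaluated: letters
    are primitive. *)
Lemma wcoprod_letter x : wcoprod (cls (tword [:: x])) =
  cls (tword [::]) \ot cls (tword [:: x]) +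
  cls (tword [:: x]) \ot cls (tword [::]).
Proof.
have sl := sigma_linear M; have [r_lin rK] := wret_wanti sl.
have rE w : (size w <= 1)%N -> wret (sigma M) (tword w) = cls (tword w).
  by move=> w1; rewrite -[RHS]rK wanti_wcls // antisym_tword_le1.
rewrite /wcoprod wanti_wcls // antisym_tword_le1 // /deconcat.
rewrite flift_gen; last exact: deconcat_letterwise.
rewrite !big_ord_recl big_ord0 /= addr0 linD; last exact: linear_tmap.
by rewrite !tmapE // !rE.
Qed.

Let wmul_bil := wmul_bilinear (@antisym_ideal _ _ _ M).

Let clp := @clmul_pure C G V Sg (twh M) (met M) (sigma M).

Lemma clmul_pure_bilinear : bilinear_map clp.
Proof.
have tb := wtwist_bilinear; have gb := wg_bilinear.
have cl := wcoprod_linear (sigma_linear M).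
by rewrite /clp /clmul_pure; lin.
Qed.

(** The two coproducts give four terms. The pairings of a letter with the empty word vanish; the
    pairing of empty words leaves the exterior product, and that of the two letters leaves the
    metric. *)
Lemma clmul_pure_letters x y : clp (cls (tword [:: x])) (cls (tword [:: y])) =
  1 \ot cls (tword [:: x; y]) + met M (x \ot y) \ot cls (tword [::]).
Proof.
have tb := wtwist_bilinear; have gb := wg_bilinear; have sl := sigma_linear M.
rewrite /clp /clmul_pure !wcoprod_letter.
rewrite linD; last by apply: tlift_linear; lin.
do 2![rewrite tliftE; last by lin].
do 2![rewrite linD; last by apply: tlift_linear; lin].
do 4![rewrite tliftE; last by lin].
rewrite !wgE !antisym_tword_le1 //.
rewrite tg_letter_nil tg_letter_letter tg_nil_nil tg_nil_letter.
rewrite !(lin0 (proj2 tb _)) wtwist_nil wtwist1_letter.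
rewrite !(lin0 (tlift_linear _)); try by lin.
rewrite add0r addr0 addrC !tliftE; try by lin.
by rewrite !(wmulE (@antisym_ideal _ _ _ M)) !tcatE.
Qed.

(** Both scalar coefficients are 1 and twisting by 1 is trivial, so the product reduces to
    [clmul_pure]. *)
Lemma clmul_letters x y :
  clmul (twh M) (met M) (1 \ot cls (tword [:: x])) (1 \ot cls (tword [:: y])) =
  1 \ot cls (tword [:: x; y]) + met M (x \ot y) \ot cls (tword [::]).
Proof.
have pb := clmul_pure_bilinear; have tb := wtwist_bilinear.
rewrite /clmul tliftE; last by lin.
rewrite tliftE; last by lin.
rewrite wtwist1_letter tliftE; last by lin.
rewrite -[clmul_pure _ _ _ _]/(clp _ _) clmul_pure_letters.
rewrite linD; last by apply: tlift_linear; lin.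
by rewrite !tliftE ?mul1r //; lin.
Qed.

End Pairing.

(** * Horizontal forms: the square of [nabla] and its equivariance *)

Section HorizontalTheory.
Variables (C : numClosedFieldType) (G : cmqg C) (P : qpb G).
Variables (V : coordSpace G) (M : qmetric V) (F : frame P (sigma M)).
Notation W := (ext (sigma M)).
Notation cls := (wcls (sigma M)).
Notation B := (Defs.total P).

Let wmul_bil := wmul_bilinear (@antisym_ideal _ _ _ M).
Let wcirc_bil := wcirc_bilinear M.
Let coact_linear : linear (coact P).
Proof. by case: (coact_coaction P). Qed.
Let coact1 : coact P 1 = 1 \ot 1.
Proof. by case: (coact_hom P). Qed.

Lemma hmul_bilinear : bilinear_map (@hmul C G P V (sigma M)).
Proof.
have := wmul_bil; have := wcirc_bil; have := coact_linear => H1 H2 H3.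
by rewrite /hmul; lin.
Qed.

(** The product moves [p] past the base element of the second factor through its coaction; that
    element is 1, which coacts trivially. *)
Lemma hmul_hor_w (q : B) (p e : W) :
  hmul (q \ot p : hor P (sigma M)) (hor_w P e) = q \ot wmul p e.
Proof.
have := wmul_bil; have := wcirc_bil; have := coact_linear => H1 H2 H3.
rewrite /hmul /hor_w !tliftE ?coact1; try by lin.
by rewrite tliftE ?mulr1 ?wcirc1 //; lin.
Qed.

Lemma hor_b_linear : linear (hor_b (sigma M) : B -> _).
Proof. by rewrite /hor_b; lin. Qed.

Lemma hcoact_hor_b (b : B) :
  hcoact (hor_b (sigma M) b) = tmap (hor_b (sigma M)) id (coact P b).
Proof.
have kl := @wkap_linear _ _ _ M; have cl := coact_linear.
have hl := hor_b_linear.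
have tb := tprod_bilinear G (tpure_bilinear B W).
rewrite /hcoact /pcoact tliftE; last by lin.
rewrite wkap_nil; move: (coact P b).
apply: tens_ext; [by lin | exact: linear_tmap | move=> b' a].
by rewrite tmapE // tprodE ?mulr1 //; apply: tpure_bilinear.
Qed.

Let tdeg_letterwise n :
  letterwise_linear (fun w : seq V => if size w == n then tword w else 0).
Proof.
move=> l r a x y; rewrite !size_cat /=; case: ifP => _.
  by rewrite tword_letterwise.
by rewrite scaler0 addr0.
Qed.

Lemma tdeg_linear n : linear (@tdeg C V n).
Proof. exact/flift_linear/tdeg_letterwise. Qed.

Lemma hdeg0_hor_b (b : B) : hdeg 0 (hor_b (sigma M) b).
Proof.
exists (b \ot tword [::]); rewrite tmapE //; last first.
  exact: linear_wcls (tdeg_linear 0).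
by rewrite /tdeg flift_gen //; apply: tdeg_letterwise.
Qed.

Lemma nabla_tpure (b : B) (p : W) :
  nabla F (b \ot p) = hmul (nabla F (hor_b (sigma M) b)) (hor_w P p).
Proof.
have [_ Hr] := hmul_bilinear; have [t ->] := wclsP p.
have -> : b \ot cls t = hmul (hor_b (sigma M) b) (hor_w P (cls t)).
  by rewrite hmul_hor_w (wmulE (@antisym_ideal _ _ _ M)) tcat0t.
(* In the Leibniz rule for [b] times a form, the second term contains [nabla] of the form alone,
   which vanishes. *)
rewrite (nabla_mul F _ (hdeg0_hor_b b)) [X in _ + _ *: hmul _ X](_ : _ = 0).
  by rewrite (lin0 (Hr _)) scaler0 addr0.
by apply: nabla_vanish; apply: hsub_gen; right; exists (cls t).
Qed.

(** The derivative taken last contributes the left letter, because by [nabla_tpure] the form already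
    present multiplies from the right. *)
Lemma nabla2E (b : B) : nabla2 F b =
  \sum_j \sum_k
     partial F k (partial F j b) \ot cls (tword [:: theta k; theta j]).
Proof.
have nl := nabla_linear F; have [Hl _] := hmul_bilinear.
rewrite /nabla2 partialE lin_sum //; apply: eq_bigr => j _.
rewrite nabla_tpure partialE (lin_sum _ _ _ (Hl _)); apply: eq_bigr => k _.
by rewrite hmul_hor_w (wmulE (@antisym_ideal _ _ _ M)) tcatE.
Qed.

Lemma nabla2_linear : linear (nabla2 F).
Proof.
have nl := nabla_linear F; have hl := hor_b_linear.
by rewrite /nabla2; lin.
Qed.

Lemma curvature_operatorE (b : B) : curvature_operator F b = - nabla2 F b.
Proof. by rewrite /nabla2 curvE opprK. Qed.

(** A general [T] allows two successive uses: with [hor_b], then with [nabla] after [hor_b]. *)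
Let nabla_equivariant (T : B -> hor P (sigma M)) : linear T ->
  (forall b, hcoact (T b) = tmap T id (coact P b)) ->
  forall b,
    hcoact (nabla F (T b)) = tmap (fun b => nabla F (T b)) id (coact P b).
Proof.
move=> Tl HT b; have nl := nabla_linear F.
rewrite nabla_coact HT; move: (coact P b).
apply: (@tens_ext _ _ _ _ (fun z => tmap (nabla F) id (tmap T id z))).
- have H := linear_tmap nl (@linear_idfun _ G).
  have H' := linear_tmap Tl (@linear_idfun _ G).
  exact: linear_comp H H'.
- by apply: linear_tmap => //; lin.
by move=> b' a; rewrite !tmapE //; lin.
Qed.

Lemma hcoact_nabla_hor_b b : hcoact (nabla F (hor_b (sigma M) b)) =
  tmap (fun b => nabla F (hor_b (sigma M) b)) id (coact P b).
Proof. exact/nabla_equivariant/hcoact_hor_b/hor_b_linear. Qed.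

Lemma hcoact_nabla2 b : hcoact (nabla2 F b) = tmap (nabla2 F) id (coact P b).
Proof.
apply: (@nabla_equivariant (fun b => nabla F (hor_b (sigma M) b))).
  by have nl := nabla_linear F; have hl := hor_b_linear; lin.
exact: hcoact_nabla_hor_b.
Qed.

(** * The Clifford action of horizontal forms on spinors *)

Section Spinors.
Variable S : spinors M.
Notation act p x := (gam S (cl_of_ext p) x).

Let spin_coact := (pcoact (coact P) (spkap S)).

Let spkap_linear : linear (spkap S).
Proof. by case: (spkap_coaction S). Qed.
Let skap_linear : linear (skap M).
Proof. by case: (skap_coaction M). Qed.

Lemma gam_bilinear : bilinear_map (fun z x => gam S z x).
Proof.
split=> [x|z] a y t; last by rewrite linearP.
by rewrite gam_linear add_lfunE scale_lfunE.
Qed.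

Let act_bilinear : bilinear_map (fun (p : W) (x : S) => act p x).
Proof.
have gb := gam_bilinear; split=> [x|p]; last by case: gb.
by apply: (bilinear_l _ gb); rewrite /cl_of_ext; lin.
Qed.

(** The bilinear core of [cliffordization], separated from the operator [T] that produces the
    form. *)
Definition clifford_action (h : hor P (sigma M)) (x : S) : spinor_fields P S :=
  sw (b, p) := h in b \ot act p x.

Lemma clifford_action_bilinear : bilinear_map clifford_action.
Proof. by have ab := act_bilinear; rewrite /clifford_action; lin. Qed.

Lemma clifford_actionE b p x : clifford_action (b \ot p) x = b \ot act p x.
Proof. by have ab := act_bilinear; rewrite /clifford_action tliftE //; lin. Qed.

Lemma spin_coact_linear : linear spin_coact.
Proof.
have sl := spkap_linear; have cl := coact_linear.
have tb := tprod_bilinear G (tpure_bilinear B S).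
by rewrite /spin_coact /pcoact; lin.
Qed.

Lemma spin_coactE b x :
  spin_coact (b \ot x) = tprod (@tpure C B S) (coact P b) (spkap S x).
Proof.
have sl := spkap_linear; have cl := coact_linear.
have tb := tprod_bilinear G (tpure_bilinear B S).
by rewrite /spin_coact /pcoact tliftE //; lin.
Qed.

(** [gam] intertwines the coactions by [spkap_gam], and the scalar part of a form, 1 in [Sig M],
    coacts trivially. What remains is associativity in the algebra of [G]. *)
Lemma spin_coact_clifford_action h x :
  spin_coact (clifford_action h x) =
  tprod clifford_action (hcoact h) (spkap S x).
Proof.
have sl := spkap_linear; have cl := coact_linear.
have kl := @wkap_linear _ _ _ M.
have skl := skap_linear; have scl := spin_coact_linear.
have cb := clifford_action_bilinear; have gb := gam_bilinear.
have tcb := tprod_bilinear G cb.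
have tgb := tprod_bilinear G gb.
have tbS := tprod_bilinear G (tpure_bilinear B S).
have tbW := tprod_bilinear G (tpure_bilinear B W).
have tbC := tprod_bilinear G (tpure_bilinear (Sig M) W).
move: h; apply: (@tens_ext _ _ _ _ (fun h => spin_coact (clifford_action h x))
  (fun h => tprod clifford_action (hcoact h) (spkap S x))).
- by lin.
- by rewrite /hcoact /pcoact; lin.
move=> b p; rewrite clifford_actionE spin_coactE spkap_gam.
rewrite /hcoact /cl_of_ext /pcoact !tliftE; try by lin.
(* The three coacted elements become arbitrary tensors, each of which can then be taken pure. *)
rewrite skap1; move: (coact P b) (wkap p) (spkap S x) => z w t.
move: z; apply: (@tens_ext _ _ _ _
  (fun z => tprod (@tpure C B S)  z (tprod _ (tprod _ _ w) t))
  (fun z => tprod clifford_action (tprod (@tpure C _ W) z w) t)); try by lin.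
move=> b' a; move: w; apply: (@tens_ext _ _ _ _
  (fun w => tprod (@tpure C B S) _ (tprod _ (tprod _ _ w) t))
  (fun w => tprod clifford_action (tprod (@tpure C _ W) _ w) t)); try by lin.
move=> p' c; move: t; apply: (@tens_ext _ _ _ _
  (fun t => tprod (@tpure C B S) _ (tprod _ _ t))
  (fun t => tprod clifford_action _ t)); try by lin.
move=> x' e; rewrite !tprodE //; try exact: tpure_bilinear.
by rewrite clifford_actionE mul1r mulrA.
Qed.

(** * Cliffordization of operators and preservation of invariant spinor fields *)

Section Cliffordization.
Variable T : B -> hor P (sigma M).
Hypothesis T_linear : linear T.

Lemma cliffordization_linear : linear (cliffordization (S := S) T).
Proof.
have cb := clifford_action_bilinear.
by rewrite /cliffordization -/(clifford_action _ _); apply: tlift_linear; lin.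
Qed.

Lemma cliffordizationE b x :
  cliffordization (S := S) T (b \ot x) = clifford_action (T b) x.
Proof.
have cb := clifford_action_bilinear.
by rewrite /cliffordization -/(clifford_action _ _) tliftE //; lin.
Qed.

Lemma in_SM_cliffordization psi :
  (forall b, hcoact (T b) = tmap T id (coact P b)) ->
  in_SM psi -> in_SM (cliffordization (S := S) T psi).
Proof.
move=> HT; have cl := cliffordization_linear; have scl := spin_coact_linear.
have cb := clifford_action_bilinear; have tcb := tprod_bilinear G cb.
have tbS := tprod_bilinear G (tpure_bilinear B S).
have idl := @linear_idfun _ G.
have tml := linear_tmap cl idl; have tTl := linear_tmap T_linear idl.
rewrite /in_SM -![pcoact _ _ _]/(spin_coact _) => Hpsi.
(* An operator that intertwines the coaction preserves its invariants; the intertwining itself is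
   proved for all spinor fields, hence can be tested on pure tensors. *)
suff -> : spin_coact (cliffordization T psi) =
    tmap (cliffordization (S := S) T) id (spin_coact psi) by rewrite Hpsi tmapE.
move: psi {Hpsi}; apply: (@tens_ext _ _ _ _ (fun psi => spin_coact _)
  (fun psi => tmap _ _ _)); try by lin.
move=> b x; rewrite cliffordizationE spin_coact_clifford_action HT spin_coactE.
move: (coact P b) (spkap S x) => z t.
move: z; apply: (@tens_ext _ _ _ _ (fun z => tprod _ (tmap T id z) t)
  (fun z => tmap _ _ (tprod _ z t))); try by lin.
move=> b' a; move: t; apply: (@tens_ext _ _ _ _ (fun t => tprod _ _ t)
  (fun t => tmap _ _ (tprod _ _ t))); try by lin.
move=> x' c; rewrite !tmapE // !tprodE //; last exact: tpure_bilinear.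
by rewrite tmapE // cliffordizationE.
Qed.

End Cliffordization.

(** Equivariance is assumed of [nabla], not of each [partial]; in this form [dirac] inherits it. *)
Let diracE (psi : spinor_fields P S) : dirac F psi =
  - 'i *: cliffordization (S := S) (fun b => nabla F (hor_b (sigma M) b)) psi.
Proof.
have nl := nabla_linear F; have hl := hor_b_linear; have pl := partial_linear F.
have gl z : linear (gam S z) by move=> a x y; rewrite linearP.
have [cb _] := clifford_action_bilinear.
have Hl : linear (fun b => nabla F (hor_b (sigma M) b)) by lin.
congr (_ *: _); move: psi; apply: tens_ext.
- by apply: linear_sum_fun => j; apply: linear_tmap.
- exact: cliffordization_linear.
move=> b x; rewrite cliffordizationE // partialE (lin_sum _ _ _ (cb _)).
by apply: eq_bigr => j _; rewrite clifford_actionE tmapE.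
Qed.

(** The sign is the one in [curvE], carried through by linearity of the Clifford action in the
    form. *)
Lemma RhatE (psi : spinor_fields P S) :
  Rhat F psi = - cliffordization (S := S) (nabla2 F) psi.
Proof.
have [cb _] := clifford_action_bilinear.
have Nl : linear (fun u : spinor_fields P S => -1 *: u) by lin.
rewrite -scaleN1r /Rhat /cliffordization (tlift_lin _ _ Nl).
congr (tlift _ psi); apply/funext => b; apply/funext => x.
rewrite curvature_operatorE -/(clifford_action _ _) -/(clifford_action _ _).
by rewrite scaleN1r (linN _ (cb x)).
Qed.

Lemma dirac_linear : linear (dirac F (S := S)).
Proof.
have nl := nabla_linear F; have hl := hor_b_linear.
have cl := @cliffordization_linear (fun b => nabla F (hor_b (sigma M) b)).
by move=> a x y; rewrite !diracE cl ?scalerDr ?scalerA 1?mulrC //; lin.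
Qed.

Lemma dirac_sq (psi : spinor_fields P S) :
  dirac F (dirac F psi) = spin_laplacian F psi + Rhat F psi.
Proof.
have pl := partial_linear F; have dl := dirac_linear.
have nl := nabla2_linear; have [cb _] := clifford_action_bilinear.
have gl z : linear (gam S z) by move=> a x y; rewrite linearP.
have ppl i j : linear (fun b => partial F i (partial F j b)).
  exact: linear_comp (pl i) (pl j).
have diracPE b x : dirac F (b \ot x) =
    - 'i *: \sum_j partial F j b \ot act (cls (tword [:: theta j])) x.
  by congr (_ *: _); apply: eq_bigr => j _; rewrite tmapE.
rewrite RhatE; move: psi.
apply: (@tens_ext _ _ _ _ (fun psi => dirac F (dirac F psi))
  (fun psi => spin_laplacian F psi - cliffordization (nabla2 F) psi)).
- exact: (linear_comp dl dl).
- have cl := cliffordization_linear nl.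
  apply: linear_add => a x y; last first.
    by rewrite cl opprD scalerN.
  rewrite /spin_laplacian scalerN -opprD; congr (- _); move: a x y.
  by do 2![apply: linear_sum_fun => ?]; apply: linear_tmap.
move=> b x; rewrite diracPE linZ // lin_sum // cliffordizationE // nabla2E.
(* The sums of the Laplacian are exchanged so that, as in [nabla2E], the outer index belongs to the
   derivative taken first. *)
rewrite (lin_sum _ _ _ (cb x)) /spin_laplacian exchange_big -opprD.
rewrite -big_split /=.
(* The sign -1 is split as (-i)(-i), one factor for each application of [dirac]. *)
rewrite -scaleN1r -[X in _ = X *: _](sqrCi C) -[X in _ = X *: _]mulrNN -scalerA.
congr (_ *: _); rewrite scaler_sumr; apply: eq_bigr => j _.
rewrite diracPE; congr (_ *: _); rewrite (lin_sum _ _ _ (cb x)) -big_split.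
apply: eq_bigr => k _ /=.
rewrite tmapE // clifford_actionE.
rewrite -(linD (proj2 (tpure_bilinear _ _) _)); congr (_ \ot _).
(* [gamM] merges the two actions into that of one Clifford product, whose scalar part belongs to the
   Laplacian and whose degree-two part belongs to [nabla2]. *)
rewrite /cl_of_ext -[LHS](comp_lfunE (gam S _) (gam S _) x) -gamM clmul_letters.
by rewrite addrC (linD (@gam_linear _ _ _ _ S)) add_lfunE /gmatrix mxE.
Qed.

Lemma in_SM_lin k (phi psi : spinor_fields P S) :
  in_SM phi -> in_SM psi -> in_SM (k *: phi + psi).
Proof.
rewrite /in_SM -![pcoact _ _ _]/(spin_coact _) => H1 H2.
by rewrite spin_coact_linear H1 H2 (proj1 (tpure_bilinear _ _) _).
Qed.

Lemma in_SM0 : in_SM (0 : spinor_fields P S).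
Proof.
rewrite /in_SM -![pcoact _ _ _]/(spin_coact _) (lin0 spin_coact_linear).
by rewrite (lin0 (proj1 (tpure_bilinear _ _) _)).
Qed.

Lemma in_SMZ k (psi : spinor_fields P S) : in_SM psi -> in_SM (k *: psi).
Proof. by move=> H; rewrite -[k *: psi]addr0; apply/in_SM_lin/in_SM0. Qed.

Lemma in_SM_dirac (psi : spinor_fields P S) : in_SM psi -> in_SM (dirac F psi).
Proof.
move=> H; rewrite diracE; apply/in_SMZ/in_SM_cliffordization => //.
  by have nl := nabla_linear F; have hl := hor_b_linear; lin.
exact: hcoact_nabla_hor_b.
Qed.

Lemma in_SM_Rhat (psi : spinor_fields P S) : in_SM psi -> in_SM (Rhat F psi).
Proof.
move=> H; rewrite RhatE -scaleN1r; apply/in_SMZ/in_SM_cliffordization => //.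
  exact: nabla2_linear.
exact: hcoact_nabla2.
Qed.

(** By [dirac_sq] the Laplacian is the square of [dirac] minus [Rhat], and both of these preserve
    invariant fields. *)
Lemma in_SM_laplacian (psi : spinor_fields P S) :
  in_SM psi -> in_SM (spin_laplacian F psi).
Proof.
move=> H; rewrite -[spin_laplacian F psi](addrK (Rhat F psi)) -dirac_sq addrC.
rewrite -scaleN1r; apply: in_SM_lin; first exact: in_SM_Rhat.
by do 2!apply: in_SM_dirac.
Qed.

End Spinors.
End HorizontalTheory.

Theorem proposition4p3 (R : realType) (G : cmqg R[i]%C) (P : qpb G)
  (V : coordSpace G) (M : qmetric V) (F : frame P (sigma M)) (S : spinors M) :
  (forall psi : spinor_fields P S, in_SM psi ->
     [/\ in_SM (dirac F psi), in_SM (spin_laplacian F psi), in_SM (Rhat F psi)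
       & dirac F (dirac F psi) = spin_laplacian F psi + Rhat F psi]) /\
  (forall psi : spinor_fields P S,
     Rhat F psi = - cliffordization (nabla2 F) psi).
Proof.
split=> [psi H|psi]; last exact: RhatE.
split; first exact: in_SM_dirac.
- exact: in_SM_laplacian.
- exact: in_SM_Rhat.
exact: dirac_sq.
Qed.
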